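(* Let $k$ be an algebraically closed field of characteristic zero and let $G$ be a finite group. The category $\mathcal{R}ep(G)$ of finite-dimensional representations of $G$ over $k$ has a dualising braided tensor autoequivalence if and only if the group $G$ has a class-inverting automorphism.
   Context: $\mathcal{R}ep(G)$ is regarded as a braided (symmetric) tensor category with its usual tensor product and symmetry. A braided tensor autoequivalence is a $k$-linear monoidal autoequivalence compatible with the braiding. A tensor autoequivalence $F:\mathcal{C}\to\mathcal{C}$ is called dualising if $F(X)\simeq X^*$ for every object $X\in\mathcal{C}$, where $X^*$ is the dual object (no naturality of these isomorphisms is required). A group automorphism $\phi:G\to G$ is called class-inverting if for any $g\in G$ there is $h\in G$ such that $\phi(g)=hg^{-1}h^{-1}$. *)

(* Defs.v *)
From HB Require Import structures.
From mathcomp Require Import all_boot all_algebra all_fingroup all_character.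
From mathcomp Require Export mxtens.

Set Implicit Arguments.
Unset Strict Implicit.
Unset Printing Implicit Defensive.

Import GRing.Theory.
Local Open Scope ring_scope.

Record lin_category (k : fieldType) := LinCategory {
  obj :> Type;
  hom : obj -> obj -> lmodType k;
  idm : forall X, hom X X;
  comp : forall X Y Z, hom Y Z -> hom X Y -> hom X Z;
  comp1m : forall X Y (f : hom X Y), comp (idm Y) f = f;
  compm1 : forall X Y (f : hom X Y), comp f (idm X) = f;
  compmA : forall X Y Z T (h : hom Z T) (g : hom Y Z) (f : hom X Y),
    comp h (comp g f) = comp (comp h g) f;
  comp_linearl : forall X Y Z (f : hom X Y),
    linear (fun g : hom Y Z => comp g f);
  comp_linearr : forall X Y Z (g : hom Y Z),
    linear (fun f : hom X Y => comp g f)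
}.
Arguments idm {k l} X.
Arguments hom {k l} X Y.
Notation "g \oc f" := (comp g f) (at level 50, left associativity).

Record iso (k : fieldType) (C : lin_category k) (X Y : C) := Iso {
  fwd :> hom X Y;
  bwd : hom Y X;
  bwdK : bwd \oc fwd = idm X;
  fwdK : fwd \oc bwd = idm Y
}.

Definition isomorphic (k : fieldType) (C : lin_category k) (X Y : C) : Prop :=
  inhabited (iso X Y).

Record lin_functor (k : fieldType) (C D : lin_category k) := LinFunctor {
  fobj :> C -> D;
  fmap : forall X Y, hom X Y -> hom (fobj X) (fobj Y);
  fmap_linear : forall X Y, linear (@fmap X Y);
  fmap_id : forall X, fmap (idm X) = idm (fobj X);
  fmap_comp : forall X Y Z (g : hom Y Z) (f : hom X Y),
    fmap (g \oc f) = fmap g \oc fmap f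
}.
Arguments fmap {k C D} F {X Y} : rename.

Section Functors.
Variable k : fieldType.

Definition id_functor (C : lin_category k) : lin_functor C C :=
  @LinFunctor k C C id (fun _ _ => id) (fun _ _ _ _ _ => erefl) (fun=> erefl)
    (fun _ _ _ _ _ => erefl).

Section Compose.
Variables (C D E : lin_category k) (G : lin_functor D E) (F : lin_functor C D).
Let cmap (X Y : C) (f : hom X Y) : hom (G (F X)) (G (F Y)) := fmap G (fmap F f).
Fact comp_functor_linear X Y : linear (@cmap X Y).
Proof. by move=> a f g; rewrite /cmap !fmap_linear. Qed.
Fact comp_functor_id X : cmap (idm X) = idm (G (F X)).
Proof. by rewrite /cmap !fmap_id. Qed.
Fact comp_functor_comp X Y Z (g : hom Y Z) (f : hom X Y) :
  cmap (g \oc f) = cmap g \oc cmap f.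
Proof. by rewrite /cmap !fmap_comp. Qed.
Definition comp_functor :=
  LinFunctor comp_functor_linear comp_functor_id comp_functor_comp.
End Compose.

Definition nat_isomorphic (C D : lin_category k) (F G : lin_functor C D) : Prop :=
  exists eta : forall X, iso (F X) (G X),
    forall X Y (f : hom X Y), eta Y \oc fmap F f = fmap G f \oc eta X.

Definition is_equivalence (C D : lin_category k) (F : lin_functor C D) : Prop :=
  exists G : lin_functor D C,
    nat_isomorphic (comp_functor G F) (id_functor C) /\
    nat_isomorphic (comp_functor F G) (id_functor D).
End Functors.

(* Rigid k-linear monoidal categories; abelianness plays no role below. The   *)
(* object dual X is the (left) dual of X, characterised up to isomorphism by  *)
(* the evaluation ev, the coevaluation coev and the two zigzag identities.    *)
Record tensor_category (k : fieldType) := TensorCategory {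
  tc_cat :> lin_category k;
  tens : tc_cat -> tc_cat -> tc_cat;
  tensm : forall X X' Y Y' : tc_cat,
    hom X X' -> hom Y Y' -> hom (tens X Y) (tens X' Y');
  tensm1 : forall X Y : tc_cat, tensm (idm X) (idm Y) = idm (tens X Y);
  tensm_comp : forall (X X' X'' Y Y' Y'' : tc_cat)
    (f' : hom X' X'') (f : hom X X') (g' : hom Y' Y'') (g : hom Y Y'),
    tensm (f' \oc f) (g' \oc g) = tensm f' g' \oc tensm f g;
  tensm_linearl : forall (X X' Y Y' : tc_cat) (g : hom Y Y'),
    linear (fun f : hom X X' => tensm f g);
  tensm_linearr : forall (X X' Y Y' : tc_cat) (f : hom X X'),
    linear (fun g : hom Y Y' => tensm f g);
  unit_obj : tc_cat;
  assoc : forall X Y Z : tc_cat, iso (tens (tens X Y) Z) (tens X (tens Y Z));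
  lunit : forall X : tc_cat, iso (tens unit_obj X) X;
  runit : forall X : tc_cat, iso (tens X unit_obj) X;
  assoc_nat : forall (X X' Y Y' Z Z' : tc_cat)
    (f : hom X X') (g : hom Y Y') (h : hom Z Z'),
    assoc X' Y' Z' \oc tensm (tensm f g) h
    = tensm f (tensm g h) \oc assoc X Y Z;
  lunit_nat : forall (X X' : tc_cat) (f : hom X X'),
    lunit X' \oc tensm (idm unit_obj) f = f \oc lunit X;
  runit_nat : forall (X X' : tc_cat) (f : hom X X'),
    runit X' \oc tensm f (idm unit_obj) = f \oc runit X;
  pentagon : forall W X Y Z : tc_cat,
    assoc W X (tens Y Z) \oc assoc (tens W X) Y Z
    = tensm (idm W) (assoc X Y Z) \oc assoc W (tens X Y) Z
        \oc tensm (assoc W X Y) (idm Z);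
  triangle : forall X Y : tc_cat,
    tensm (idm X) (lunit Y) \oc assoc X unit_obj Y = tensm (runit X) (idm Y);
  dual : tc_cat -> tc_cat;
  ev : forall X, hom (tens (dual X) X) unit_obj;
  coev : forall X, hom unit_obj (tens X (dual X));
  zigzag : forall X,
    runit X \oc tensm (idm X) (ev X) \oc assoc X (dual X) X
      \oc tensm (coev X) (idm X) \oc bwd (lunit X) = idm X;
  zigzag_dual : forall X,
    lunit (dual X) \oc tensm (ev X) (idm (dual X))
      \oc bwd (assoc (dual X) X (dual X))
      \oc tensm (idm (dual X)) (coev X) \oc bwd (runit (dual X)) = idm (dual X)
}.
Arguments unit_obj {k t}.
Notation "X \ox Y" := (tens X Y) (at level 40, left associativity).
Notation "f \om g" := (tensm f g) (at level 40, left associativity).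

Record braided_category (k : fieldType) := BraidedCategory {
  bc_tens :> tensor_category k;
  braid : forall X Y : bc_tens, iso (X \ox Y) (Y \ox X);
  braid_nat : forall (X X' Y Y' : bc_tens) (f : hom X X') (g : hom Y Y'),
    braid X' Y' \oc (f \om g) = (g \om f) \oc braid X Y;
  hexagonl : forall X Y Z : bc_tens,
    assoc Y Z X \oc braid X (Y \ox Z) \oc assoc X Y Z
    = (idm Y \om braid X Z) \oc assoc Y X Z \oc (braid X Y \om idm Z);
  hexagonr : forall X Y Z : bc_tens,
    bwd (assoc Z X Y) \oc braid (X \ox Y) Z \oc bwd (assoc X Y Z)
    = (braid X Z \om idm Y) \oc bwd (assoc X Z Y) \oc (idm X \om braid Y Z)
}.

Definition is_symmetric (k : fieldType) (C : braided_category k) : Prop :=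
  forall X Y : C, braid Y X \oc braid X Y = idm (X \ox Y).

Record tensor_functor (k : fieldType) (C D : tensor_category k) :=
  TensorFunctor {
  tf_fun :> lin_functor C D;
  tf_mu : forall X Y : C, iso (tf_fun X \ox tf_fun Y) (tf_fun (X \ox Y));
  tf_eps : iso unit_obj (tf_fun unit_obj);
  tf_mu_nat : forall (X X' Y Y' : C) (f : hom X X') (g : hom Y Y'),
    tf_mu X' Y' \oc (fmap tf_fun f \om fmap tf_fun g)
    = fmap tf_fun (f \om g) \oc tf_mu X Y;
  tf_assoc : forall X Y Z : C,
    fmap tf_fun (assoc X Y Z) \oc tf_mu (X \ox Y) Z
      \oc (tf_mu X Y \om idm (tf_fun Z))
    = tf_mu X (Y \ox Z) \oc (idm (tf_fun X) \om tf_mu Y Z)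
      \oc assoc (tf_fun X) (tf_fun Y) (tf_fun Z);
  tf_lunit : forall X : C,
    fmap tf_fun (lunit X) \oc tf_mu unit_obj X \oc (tf_eps \om idm (tf_fun X))
    = lunit (tf_fun X);
  tf_runit : forall X : C,
    fmap tf_fun (runit X) \oc tf_mu X unit_obj \oc (idm (tf_fun X) \om tf_eps)
    = runit (tf_fun X)
}.
Arguments tf_mu {k C D} F X Y : rename.

Definition is_braided (k : fieldType) (C D : braided_category k)
    (F : tensor_functor C D) : Prop :=
  forall X Y : C, fmap F (braid X Y) \oc tf_mu F X Y
                  = tf_mu F Y X \oc braid (F X) (F Y).

Definition dualising (k : fieldType) (C : tensor_category k)
    (F : tensor_functor C C) : Prop :=
  forall X : C, isomorphic (F X) (dual X).

(* A representation X : representation k G of degree n acts on the space k^n  *)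
(* of COLUMN vectors by g.v = X g *m v, so that (g h).v = g.(h.v), and a      *)
(* morphism X -> Y is a matrix of size degree Y * degree X. The values of X   *)
(* outside G are irrelevant. Every finite-dimensional representation has this *)
(* form after a choice of basis.                                              *)

Section RepHom.
Variables (k : fieldType) (gT : finGroupType) (G : {group gT}).
Variables X Y : representation k G.

Definition intertwining : {pred 'M[k]_(rdegree Y, rdegree X)} :=
  [pred f | [forall g in G, f *m X g == Y g *m f]].

Lemma intertwiningP f :
  reflect (forall g, g \in G -> f *m X g = Y g *m f) (f \in intertwining).
Proof.
apply: (iffP forall_inP) => h g Gg; first exact/eqP/h.
by apply/eqP/h.
Qed.

Fact intertwining_submod_closed : submod_closed intertwining.
Proof.
split=> [|a u v /intertwiningP hu /intertwiningP hv]; apply/intertwiningP=> g Gg.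
  by rewrite mul0mx mulmx0.
by rewrite mulmxDl mulmxDr -scalemxAl -scalemxAr hu ?hv.
Qed.
HB.instance Definition _ :=
  GRing.isSubmodClosed.Build k _ intertwining intertwining_submod_closed.

Record rep_hom := RepHom {
  rep_mx :> 'M[k]_(rdegree Y, rdegree X);
  _ : rep_mx \in intertwining
}.
HB.instance Definition _ := [isSub for rep_mx].
HB.instance Definition _ := [Choice of rep_hom by <:].
HB.instance Definition _ := [SubChoice_isSubLmodule of rep_hom by <:].

Lemma rep_homP (f : rep_hom) g : g \in G -> f *m X g = Y g *m f.
Proof. by have /intertwiningP := valP f; apply. Qed.

Definition rep_hom_of f (hf : forall g, g \in G -> f *m X g = Y g *m f) :=
  RepHom (introT (intertwiningP f) hf).
End RepHom.

(* The matrix of the linear map sending the basis vector e_j to e_(f j).      *)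
Definition basis_mx (k : fieldType) (m n : nat) (f : 'I_n -> 'I_m) :
    'M[k]_(m, n) :=
  \matrix_(i, j) (i == f j)%:R.

Section BasisMx.
Variable k : fieldType.
Local Notation basis_mx := (basis_mx k).

Lemma mul_basis_mx m n p (f : 'I_n -> 'I_m) (g : 'I_m -> 'I_n) :
  cancel f g -> cancel g f -> forall A : 'M[k]_(n, p),
  basis_mx f *m A = \matrix_(i, j) A (g i) j.
Proof.
move=> fK gK A; apply/matrixP=> i j; rewrite !mxE (bigD1 (g i)) //= !mxE gK eqxx.
rewrite mul1r big1 ?addr0 // => l; rewrite !mxE.
by case: (i =P f l) => [->|]; rewrite ?fK ?eqxx ?mul0r.
Qed.

Lemma mulmx_basis m n p (f : 'I_n -> 'I_m) (A : 'M[k]_(p, m)) :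
  A *m basis_mx f = \matrix_(i, j) A i (f j).
Proof.
apply/matrixP=> i j; rewrite !mxE (bigD1 (f j)) //= !mxE eqxx mulr1.
by rewrite big1 ?addr0 // => l /negPf nl; rewrite !mxE nl mulr0.
Qed.

Lemma basis_mx_comp m n p (f : 'I_n -> 'I_m) (g : 'I_p -> 'I_n) :
  basis_mx f *m basis_mx g = basis_mx (f \o g).
Proof. by rewrite mulmx_basis; apply/matrixP=> i j; rewrite !mxE. Qed.

Lemma basis_mx_id n (f : 'I_n -> 'I_n) : f =1 id -> basis_mx f = 1%:M.
Proof. by move=> f1; apply/matrixP=> i j; rewrite !mxE f1. Qed.

Lemma eq_basis_mx m n (f g : 'I_n -> 'I_m) : f =1 g -> basis_mx f = basis_mx g.
Proof. by move=> fg; apply/matrixP=> i j; rewrite !mxE fg. Qed.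

Definition prod_idx m n p q (f : 'I_n -> 'I_m) (g : 'I_q -> 'I_p)
    (l : 'I_(n * q)) : 'I_(m * p) :=
  mxtens_index (f (mxtens_unindex l).1, g (mxtens_unindex l).2).

Lemma basis_mx_tens m n p q (f : 'I_n -> 'I_m) (g : 'I_q -> 'I_p) :
  basis_mx f *t basis_mx g = basis_mx (prod_idx f g).
Proof.
apply/matrixP=> i j; case: (mxtens_indexP i) => i1 i2; rewrite !mxE.
by rewrite (can_eq (@mxtens_indexK _ _)) mxtens_indexK xpair_eqE -natrM mulnb.
Qed.
End BasisMx.

(* Bijections of bases: e_(ij)k |-> e_i(jk), e_0i |-> e_i, e_i0 |-> e_i and   *)
(* e_ij |-> e_ji, where mxtens_index (i, j) is the index of e_i (x) e_j.      *)
Section Indices.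
Variables m n p : nat.
Definition assoc_idx (l : 'I_(m * n * p)) : 'I_(m * (n * p)) :=
  let: (ij, c) := mxtens_unindex l in
  let: (a, b) := mxtens_unindex ij in
  mxtens_index (a, mxtens_index (b, c)).
Definition assoc_idxV (l : 'I_(m * (n * p))) : 'I_(m * n * p) :=
  let: (a, jk) := mxtens_unindex l in
  let: (b, c) := mxtens_unindex jk in
  mxtens_index (mxtens_index (a, b), c).
Definition lunit_idx (l : 'I_(1 * n)) : 'I_n := (mxtens_unindex l).2.
Definition lunit_idxV (i : 'I_n) : 'I_(1 * n) := mxtens_index (ord0, i).
Definition runit_idx (l : 'I_(n * 1)) : 'I_n := (mxtens_unindex l).1.
Definition runit_idxV (i : 'I_n) : 'I_(n * 1) := mxtens_index (i, ord0).
Definition swap_idx (l : 'I_(m * n)) : 'I_(n * m) :=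
  let: (a, b) := mxtens_unindex l in mxtens_index (b, a).

Lemma assoc_idxE a b c :
  assoc_idx (mxtens_index (mxtens_index (a, b), c))
  = mxtens_index (a, mxtens_index (b, c)).
Proof. by rewrite /assoc_idx !mxtens_indexK. Qed.
Lemma assoc_idxVE a b c :
  assoc_idxV (mxtens_index (a, mxtens_index (b, c)))
  = mxtens_index (mxtens_index (a, b), c).
Proof. by rewrite /assoc_idxV !mxtens_indexK. Qed.
Lemma swap_idxE a b : swap_idx (mxtens_index (a, b)) = mxtens_index (b, a).
Proof. by rewrite /swap_idx mxtens_indexK. Qed.
Lemma lunit_idxE a b : lunit_idx (mxtens_index (a, b)) = b.
Proof. by rewrite /lunit_idx mxtens_indexK. Qed.
Lemma runit_idxE a b : runit_idx (mxtens_index (a, b)) = a.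
Proof. by rewrite /runit_idx mxtens_indexK. Qed.
Lemma assoc_idxK : cancel assoc_idx assoc_idxV.
Proof.
move=> l; case: (mxtens_indexP l) => ij c; case: (mxtens_indexP ij) => a b.
by rewrite assoc_idxE assoc_idxVE.
Qed.
Lemma assoc_idxVK : cancel assoc_idxV assoc_idx.
Proof.
move=> l; case: (mxtens_indexP l) => a jk; case: (mxtens_indexP jk) => b c.
by rewrite assoc_idxVE assoc_idxE.
Qed.
Lemma lunit_idxK : cancel lunit_idx lunit_idxV.
Proof.
by move=> l; case: (mxtens_indexP l) => a b; rewrite lunit_idxE (ord1 a).
Qed.
Lemma lunit_idxVK : cancel lunit_idxV lunit_idx.
Proof. by move=> i; rewrite /lunit_idxV lunit_idxE. Qed.
Lemma runit_idxK : cancel runit_idx runit_idxV.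
Proof.
by move=> l; case: (mxtens_indexP l) => a b; rewrite runit_idxE (ord1 b).
Qed.
Lemma runit_idxVK : cancel runit_idxV runit_idx.
Proof. by move=> i; rewrite /runit_idxV runit_idxE. Qed.
End Indices.

Lemma swap_idxK m n : cancel (@swap_idx m n) (@swap_idx n m).
Proof.
by move=> l; case: (mxtens_indexP l) => a b; rewrite !swap_idxE.
Qed.

Lemma prod_idxE m n p q (f : 'I_n -> 'I_m) (g : 'I_q -> 'I_p) a b :
  prod_idx f g (mxtens_index (a, b)) = mxtens_index (f a, g b).
Proof. by rewrite /prod_idx mxtens_indexK. Qed.

Lemma tens1mx1 (k : fieldType) m n :
  (1%:M : 'M[k]_m) *t (1%:M : 'M[k]_n) = 1%:M.
Proof.
apply/matrixP=> i j; case: (mxtens_indexP i) => a b.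
case: (mxtens_indexP j) => c d.
by rewrite tensmxE !mxE (can_eq (@mxtens_indexK _ _)) xpair_eqE -natrM mulnb.
Qed.

Section Rep.
Variables (k : fieldType) (gT : finGroupType) (G : {group gT}).
Local Notation rep := (representation k G).
Local Notation rhom := (@rep_hom k gT G).
Implicit Types X Y Z W : rep.

Fact rep_id_subproof X g :
  g \in G -> (1%:M : 'M_(rdegree X)) *m X g = X g *m 1%:M.
Proof. by rewrite mul1mx mulmx1. Qed.
Definition rep_id X : rhom X X := rep_hom_of (@rep_id_subproof X).

Fact rep_comp_subproof X Y Z (g : rhom Y Z) (f : rhom X Y) x :
  x \in G -> (g *m f) *m X x = Z x *m (g *m f).
Proof. by move=> Gx; rewrite -mulmxA rep_homP // !mulmxA rep_homP. Qed.
Definition rep_comp X Y Z (g : rhom Y Z) (f : rhom X Y) : rhom X Z :=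
  rep_hom_of (@rep_comp_subproof X Y Z g f).

Lemma rep_hom_inj X Y (f g : rhom X Y) : f = g :> 'M_(_, _) -> f = g.
Proof. exact: val_inj. Qed.

Fact rep_comp1m X Y (f : rhom X Y) : rep_comp (rep_id Y) f = f.
Proof. by apply: rep_hom_inj; apply: mul1mx. Qed.
Fact rep_compm1 X Y (f : rhom X Y) : rep_comp f (rep_id X) = f.
Proof. by apply: rep_hom_inj; apply: mulmx1. Qed.
Fact rep_compmA X Y Z W (h : rhom Z W) (g : rhom Y Z) (f : rhom X Y) :
  rep_comp h (rep_comp g f) = rep_comp (rep_comp h g) f.
Proof. by apply: rep_hom_inj; apply: mulmxA. Qed.
Fact rep_comp_linearl X Y Z (f : rhom X Y) :
  linear (fun g : rhom Y Z => rep_comp g f).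
Proof. by move=> a u v; apply: rep_hom_inj; rewrite /= mulmxDl -scalemxAl. Qed.
Fact rep_comp_linearr X Y Z (g : rhom Y Z) :
  linear (fun f : rhom X Y => rep_comp g f).
Proof. by move=> a u v; apply: rep_hom_inj; rewrite /= mulmxDr -scalemxAr. Qed.

Definition rep_lin_category : lin_category k :=
  @LinCategory k rep rhom rep_id rep_comp rep_comp1m rep_compm1 rep_compmA
    rep_comp_linearl rep_comp_linearr.

Fact rep_iso_subproof X Y (f : rhom X Y) (g : rhom Y X) :
  g *m f = 1%:M -> rep_comp g f = rep_id X.
Proof. by move=> gf; apply: rep_hom_inj. Qed.
Definition rep_iso X Y (f : rhom X Y) (g : rhom Y X)
    (gf : g *m f = 1%:M) (fg : f *m g = 1%:M) : @iso k rep_lin_category X Y :=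
  @Iso k rep_lin_category X Y f g (rep_iso_subproof gf) (rep_iso_subproof fg).

Fact rep_tens_mx_repr X Y : mx_repr G (fun g => X g *t Y g).
Proof.
split=> [|g h Gg Gh]; first by rewrite !repr_mx1 tens1mx1.
by rewrite !repr_mxM // tensmx_mul.
Qed.
Definition rep_tens X Y : rep :=
  Representation (MxRepresentation (rep_tens_mx_repr X Y)).

Fact rep_unit_mx_repr : mx_repr G (fun _ : gT => 1%:M : 'M[k]_1).
Proof. by split=> // g h _ _; rewrite mulmx1. Qed.
Definition rep_unit : rep := Representation (MxRepresentation rep_unit_mx_repr).

(* The contragredient representation: the action on linear forms, written in  *)
(* the dual basis.                                                            *)
Fact rep_dual_mx_repr X : mx_repr G (fun g => (X g^-1%g)^T).
Proof.
split=> [|g h Gg Gh]; first by rewrite invg1 repr_mx1 trmx1.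
by rewrite invMg repr_mxM ?groupV // trmx_mul.
Qed.
Definition rep_dual X : rep :=
  Representation (MxRepresentation (rep_dual_mx_repr X)).

Fact rep_tensm_subproof X X' Y Y' (f : rhom X X') (g : rhom Y Y') x :
  x \in G ->
  (f *t g) *m rep_tens X Y x = rep_tens X' Y' x *m (f *t g).
Proof. by move=> Gx; rewrite /= !tensmx_mul !rep_homP. Qed.
Definition rep_tensm X X' Y Y' (f : rhom X X') (g : rhom Y Y') :
    rhom (rep_tens X Y) (rep_tens X' Y') :=
  @rep_hom_of k gT G (rep_tens X Y) (rep_tens X' Y') (f *t g)
    (@rep_tensm_subproof X X' Y Y' f g).

Fact rep_tensm1 X Y : rep_tensm (rep_id X) (rep_id Y) = rep_id (rep_tens X Y).
Proof. by apply: rep_hom_inj; apply: tens1mx1. Qed.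
Fact rep_tensm_comp X X' X'' Y Y' Y'' (f' : rhom X' X'') (f : rhom X X')
    (g' : rhom Y' Y'') (g : rhom Y Y') :
  rep_tensm (rep_comp f' f) (rep_comp g' g)
  = rep_comp (rep_tensm f' g') (rep_tensm f g).
Proof. by apply: rep_hom_inj; rewrite /= tensmx_mul. Qed.
Fact rep_tensm_linearl X X' Y Y' (g : rhom Y Y') :
  linear (fun f : rhom X X' => rep_tensm f g).
Proof.
move=> a u v; apply: rep_hom_inj; apply/matrixP=> i j.
by rewrite !mxE mulrDl mulrA.
Qed.
Fact rep_tensm_linearr X X' Y Y' (f : rhom X X') :
  linear (fun g : rhom Y Y' => rep_tensm f g).
Proof.
move=> a u v; apply: rep_hom_inj; apply/matrixP=> i j.
by rewrite !mxE mulrDr mulrCA.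
Qed.

Section BasisIso.
Variables (X Y : rep).
Variables (f : 'I_(rdegree X) -> 'I_(rdegree Y)).
Variables (g : 'I_(rdegree Y) -> 'I_(rdegree X)).
Hypotheses (fK : cancel f g) (gK : cancel g f).
Hypothesis XY : forall x, x \in G -> forall i j, Y x (f i) (f j) = X x i j.

Fact basis_fwd_subproof x : x \in G -> basis_mx k f *m X x = Y x *m basis_mx k f.
Proof.
move=> Gx; rewrite (mul_basis_mx fK gK) mulmx_basis; apply/matrixP=> i j.
by rewrite !mxE -XY // gK.
Qed.
Fact basis_bwd_subproof x : x \in G -> basis_mx k g *m Y x = X x *m basis_mx k g.
Proof.
move=> Gx; rewrite (mul_basis_mx gK fK) mulmx_basis; apply/matrixP=> i j.
by rewrite !mxE -XY // gK.
Qed.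
Fact basis_bwdK : basis_mx k g *m basis_mx k f = 1%:M.
Proof. by rewrite basis_mx_comp basis_mx_id. Qed.
Fact basis_fwdK : basis_mx k f *m basis_mx k g = 1%:M.
Proof. by rewrite basis_mx_comp basis_mx_id. Qed.
Definition basis_iso : @iso k rep_lin_category X Y :=
  @rep_iso X Y (rep_hom_of basis_fwd_subproof) (rep_hom_of basis_bwd_subproof)
    basis_bwdK basis_fwdK.
End BasisIso.

Fact rep_assoc_subproof X Y Z x : x \in G -> forall i j,
  rep_tens X (rep_tens Y Z) x (assoc_idx i) (assoc_idx j)
  = rep_tens (rep_tens X Y) Z x i j.
Proof.
move=> Gx i j /=; case: (mxtens_indexP i) => a i3; case: (mxtens_indexP a) => i1 i2.
case: (mxtens_indexP j) => b j3; case: (mxtens_indexP b) => j1 j2.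
by rewrite !assoc_idxE !tensmxE mulrA.
Qed.
Definition rep_assoc X Y Z :
    @iso k rep_lin_category (rep_tens (rep_tens X Y) Z) (rep_tens X (rep_tens Y Z)) :=
  @basis_iso (rep_tens (rep_tens X Y) Z) (rep_tens X (rep_tens Y Z))
    _ _ (@assoc_idxK _ _ _) (@assoc_idxVK _ _ _) (@rep_assoc_subproof X Y Z).

Fact rep_lunit_subproof X x : x \in G -> forall i j,
  X x (lunit_idx i) (lunit_idx j) = rep_tens rep_unit X x i j.
Proof.
move=> Gx i j /=; case: (mxtens_indexP i) => a b; case: (mxtens_indexP j) => c d.
by rewrite !lunit_idxE tensmxE mxE (ord1 a) (ord1 c) mul1r.
Qed.
Definition rep_lunit X : @iso k rep_lin_category (rep_tens rep_unit X) X :=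
  @basis_iso (rep_tens rep_unit X) X
    _ _ (@lunit_idxK _) (@lunit_idxVK _) (@rep_lunit_subproof X).

Fact rep_runit_subproof X x : x \in G -> forall i j,
  X x (runit_idx i) (runit_idx j) = rep_tens X rep_unit x i j.
Proof.
move=> Gx i j /=; case: (mxtens_indexP i) => a b; case: (mxtens_indexP j) => c d.
by rewrite !runit_idxE tensmxE mxE (ord1 b) (ord1 d) mulr1.
Qed.
Definition rep_runit X : @iso k rep_lin_category (rep_tens X rep_unit) X :=
  @basis_iso (rep_tens X rep_unit) X
    _ _ (@runit_idxK _) (@runit_idxVK _) (@rep_runit_subproof X).

Fact rep_braid_subproof X Y x : x \in G -> forall i j,
  rep_tens Y X x (swap_idx i) (swap_idx j) = rep_tens X Y x i j.
Proof.
move=> Gx i j /=; case: (mxtens_indexP i) => a b; case: (mxtens_indexP j) => c d.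
by rewrite !swap_idxE !tensmxE mulrC.
Qed.
Definition rep_braid X Y :
    @iso k rep_lin_category (rep_tens X Y) (rep_tens Y X) :=
  @basis_iso (rep_tens X Y) (rep_tens Y X)
    _ _ (@swap_idxK _ _) (@swap_idxK _ _) (@rep_braid_subproof X Y).

(* ev (xi (x) v) = xi(v) and coev 1 = \sum_i e_i (x) e_i^*.                   *)
Definition ev_mx n : 'M[k]_(1, n * n) :=
  \row_l ((mxtens_unindex l).1 == (mxtens_unindex l).2)%:R.
Definition coev_mx n : 'M[k]_(n * n, 1) := (ev_mx n)^T.

Lemma ev_mxE n a i j : ev_mx n a (mxtens_index (i, j)) = (i == j)%:R.
Proof. by rewrite mxE mxtens_indexK. Qed.

Lemma sum_tens (R : nmodType) m n (F : 'I_(m * n) -> R) :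
  \sum_l F l = \sum_i \sum_j F (mxtens_index (i, j)).
Proof.
rewrite pair_big (reindex (@mxtens_index m n)) /=; first by apply: eq_bigr => -[].
by exists (@mxtens_unindex m n) => l _; rewrite (mxtens_indexK, mxtens_unindexK).
Qed.

Lemma ev_mx_tens n (A B : 'M[k]_n) :
  A^T *m B = 1%:M -> ev_mx n *m (A *t B) = ev_mx n.
Proof.
move=> AB; apply/matrixP=> a l; case: (mxtens_indexP l) => c d.
rewrite ev_mxE; transitivity ((A^T *m B) c d); last by rewrite AB mxE.
rewrite !mxE sum_tens; apply: eq_bigr => i _; rewrite (bigD1 i) //= big1 => [|j ji].
  by rewrite ev_mxE eqxx mul1r tensmxE addr0 mxE.
by rewrite ev_mxE eq_sym (negPf ji) mul0r.
Qed.

Fact rep_ev_subproof X x : x \in G ->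
  ev_mx (rdegree X) *m rep_tens (rep_dual X) X x
  = rep_unit x *m ev_mx (rdegree X).
Proof.
move=> Gx; rewrite mul1mx ev_mx_tens // trmxK -repr_mxM ?groupV //.
by rewrite mulVg repr_mx1.
Qed.
Definition rep_ev X : rhom (rep_tens (rep_dual X) X) rep_unit :=
  @rep_hom_of k gT G (rep_tens (rep_dual X) X) rep_unit (ev_mx (rdegree X))
    (@rep_ev_subproof X).

Fact rep_coev_subproof X x : x \in G ->
  coev_mx (rdegree X) *m rep_unit x
  = rep_tens X (rep_dual X) x *m coev_mx (rdegree X).
Proof.
move=> Gx; rewrite mulmx1 /coev_mx /=; apply: trmx_inj.
rewrite trmx_mul !trmxK trmx_tens trmxK ev_mx_tens //.
by rewrite trmxK -repr_mxM ?groupV // mulgV repr_mx1.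
Qed.
Definition rep_coev X : rhom rep_unit (rep_tens X (rep_dual X)) :=
  @rep_hom_of k gT G rep_unit (rep_tens X (rep_dual X)) (coev_mx (rdegree X))
    (@rep_coev_subproof X).

Local Notation "g \oc f" := (@comp k rep_lin_category _ _ _ g f).

Fact rep_assoc_nat X X' Y Y' Z Z' (f : rhom X X') (g : rhom Y Y')
    (h : rhom Z Z') :
  rep_assoc X' Y' Z' \oc rep_tensm (rep_tensm f g) h
  = rep_tensm f (rep_tensm g h) \oc rep_assoc X Y Z.
Proof.
apply: rep_hom_inj => /=.
rewrite (mul_basis_mx (@assoc_idxK _ _ _) (@assoc_idxVK _ _ _)) mulmx_basis.
apply/matrixP=> i j; case: (mxtens_indexP i) => i1 a.
case: (mxtens_indexP a) => i2 i3; case: (mxtens_indexP j) => b j3.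
case: (mxtens_indexP b) => j1 j2; rewrite mxE [RHS]mxE.
by rewrite assoc_idxE assoc_idxVE !tensmxE mulrA.
Qed.

Fact rep_lunit_nat X X' (f : rhom X X') :
  rep_lunit X' \oc rep_tensm (rep_id rep_unit) f = f \oc rep_lunit X.
Proof.
apply: rep_hom_inj => /=.
rewrite (mul_basis_mx (@lunit_idxK _) (@lunit_idxVK _)) mulmx_basis.
apply/matrixP=> i j; case: (mxtens_indexP j) => a b; rewrite mxE [RHS]mxE.
by rewrite lunit_idxE tensmxE mxE (ord1 a) mul1r.
Qed.

Fact rep_runit_nat X X' (f : rhom X X') :
  rep_runit X' \oc rep_tensm f (rep_id rep_unit) = f \oc rep_runit X.
Proof.
apply: rep_hom_inj => /=.
rewrite (mul_basis_mx (@runit_idxK _) (@runit_idxVK _)) mulmx_basis.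
apply/matrixP=> i j; case: (mxtens_indexP j) => a b; rewrite mxE [RHS]mxE.
by rewrite runit_idxE tensmxE mxE (ord1 b) mulr1.
Qed.

Let basis_id n : (1%:M : 'M[k]_n) = basis_mx k id.
Proof. by rewrite basis_mx_id. Qed.

Fact rep_pentagon W X Y Z :
  rep_assoc W X (rep_tens Y Z) \oc rep_assoc (rep_tens W X) Y Z
  = rep_tensm (rep_id W) (fwd (rep_assoc X Y Z)) \oc rep_assoc W (rep_tens X Y) Z
      \oc rep_tensm (fwd (rep_assoc W X Y)) (rep_id Z).
Proof.
apply: rep_hom_inj => /=.
rewrite !basis_id !basis_mx_tens !basis_mx_comp; apply: eq_basis_mx => l.
case: (mxtens_indexP l) => a l4; case: (mxtens_indexP a) => b l3.
case: (mxtens_indexP b) => l1 l2 /=.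
by rewrite !(prod_idxE, assoc_idxE).
Qed.

Fact rep_triangle X Y :
  rep_tensm (rep_id X) (fwd (rep_lunit Y)) \oc rep_assoc X rep_unit Y
  = rep_tensm (fwd (rep_runit X)) (rep_id Y).
Proof.
apply: rep_hom_inj => /=.
rewrite !basis_id !basis_mx_tens !basis_mx_comp; apply: eq_basis_mx => l.
case: (mxtens_indexP l) => a l3; case: (mxtens_indexP a) => l1 l2 /=.
by rewrite !(prod_idxE, assoc_idxE, lunit_idxE, runit_idxE).
Qed.

Lemma sum_delta n (j : 'I_n) (F : 'I_n -> k) :
  \sum_i (i == j)%:R * F i = F j.
Proof.
rewrite (bigD1 j) //= eqxx mul1r big1 ?addr0 // => i /negPf->.
by rewrite mul0r.
Qed.

Lemma zigzag_mx n :
  basis_mx k (@runit_idx n) *m (1%:M *t ev_mx n) *m basis_mx k (@assoc_idx n n n)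
    *m (coev_mx n *t 1%:M) *m basis_mx k (@lunit_idxV n) = 1%:M.
Proof.
rewrite (mul_basis_mx (@runit_idxK _) (@runit_idxVK _)) !mulmx_basis.
apply/matrixP=> i j; rewrite mxE [LHS]mxE sum_tens sum_tens.
transitivity (\sum_a (a == i)%:R * \sum_b (b == a)%:R
              * \sum_c (c == b)%:R * (c == j)%:R : k).
  apply: eq_bigr => a _; rewrite big_distrr; apply: eq_bigr => b _ /=.
  rewrite !big_distrr; apply: eq_bigr => c _ /=.
  rewrite ![X in X * _ = _]mxE assoc_idxE /runit_idxV /lunit_idxV tensmxE.
  rewrite /coev_mx [_^T _ _]mxE !ev_mxE !mxE !mxtens_indexK /= (eq_sym i).
  by rewrite (eq_sym a b) (eq_sym b c) -!mulrA; congr (_ * _); rewrite mulrCA.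
by rewrite !sum_delta !mxE.
Qed.

Lemma zigzag_dual_mx n :
  basis_mx k (@lunit_idx n) *m (ev_mx n *t 1%:M) *m basis_mx k (@assoc_idxV n n n)
    *m (1%:M *t coev_mx n) *m basis_mx k (@runit_idxV n) = 1%:M.
Proof.
rewrite (mul_basis_mx (@lunit_idxK _) (@lunit_idxVK _)) !mulmx_basis.
apply/matrixP=> i j; rewrite mxE [LHS]mxE sum_tens.
transitivity (\sum_a (a == j)%:R * \sum_b (b == a)%:R
              * \sum_c (c == b)%:R * (c == i)%:R : k).
  apply: eq_bigr => a _; rewrite sum_tens big_distrr; apply: eq_bigr => b _ /=.
  rewrite !big_distrr; apply: eq_bigr => c _ /=.
  rewrite ![X in X * _ = _]mxE assoc_idxVE /runit_idxV /lunit_idxV tensmxE.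
  rewrite /coev_mx [_^T _ _]mxE !ev_mxE !mxE !mxtens_indexK /= (eq_sym i).
  rewrite (eq_sym a b) (eq_sym b c) mulrC -!mulrA; congr (_ * _).
  by rewrite mulrCA.
by rewrite !sum_delta !mxE eq_sym.
Qed.

Fact rep_zigzag X :
  rep_runit X \oc rep_tensm (rep_id X) (rep_ev X) \oc rep_assoc X (rep_dual X) X
    \oc rep_tensm (rep_coev X) (rep_id X) \oc bwd (rep_lunit X) = rep_id X.
Proof. by apply: rep_hom_inj; apply: zigzag_mx. Qed.

Fact rep_zigzag_dual X :
  rep_lunit (rep_dual X) \oc rep_tensm (rep_ev X) (rep_id (rep_dual X))
    \oc bwd (rep_assoc (rep_dual X) X (rep_dual X))
    \oc rep_tensm (rep_id (rep_dual X)) (rep_coev X)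
    \oc bwd (rep_runit (rep_dual X)) = rep_id (rep_dual X).
Proof. by apply: rep_hom_inj; apply: zigzag_dual_mx. Qed.

Definition rep_tensor_category : tensor_category k :=
  @TensorCategory k rep_lin_category rep_tens rep_tensm rep_tensm1
    rep_tensm_comp rep_tensm_linearl rep_tensm_linearr rep_unit
    rep_assoc rep_lunit rep_runit rep_assoc_nat rep_lunit_nat rep_runit_nat
    rep_pentagon rep_triangle rep_dual rep_ev rep_coev
    rep_zigzag rep_zigzag_dual.

Fact rep_braid_nat X X' Y Y' (f : rhom X X') (g : rhom Y Y') :
  rep_braid X' Y' \oc rep_tensm f g = rep_tensm g f \oc rep_braid X Y.
Proof.
apply: rep_hom_inj => /=.
rewrite (mul_basis_mx (@swap_idxK _ _) (@swap_idxK _ _)) mulmx_basis.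
apply/matrixP=> i j; case: (mxtens_indexP i) => i1 i2.
case: (mxtens_indexP j) => j1 j2; rewrite mxE [RHS]mxE.
by rewrite !swap_idxE !tensmxE mulrC.
Qed.

Fact rep_hexagonl X Y Z :
  rep_assoc Y Z X \oc rep_braid X (rep_tens Y Z) \oc rep_assoc X Y Z
  = rep_tensm (rep_id Y) (fwd (rep_braid X Z)) \oc rep_assoc Y X Z
      \oc rep_tensm (fwd (rep_braid X Y)) (rep_id Z).
Proof.
apply: rep_hom_inj => /=.
rewrite !basis_id !basis_mx_tens !basis_mx_comp; apply: eq_basis_mx => l.
case: (mxtens_indexP l) => a l3; case: (mxtens_indexP a) => l1 l2 /=.
by rewrite !(prod_idxE, assoc_idxE, swap_idxE).
Qed.

Fact rep_hexagonr X Y Z :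
  bwd (rep_assoc Z X Y) \oc rep_braid (rep_tens X Y) Z \oc bwd (rep_assoc X Y Z)
  = rep_tensm (fwd (rep_braid X Z)) (rep_id Y) \oc bwd (rep_assoc X Z Y)
      \oc rep_tensm (rep_id X) (fwd (rep_braid Y Z)).
Proof.
apply: rep_hom_inj => /=.
rewrite !basis_id !basis_mx_tens !basis_mx_comp; apply: eq_basis_mx => l.
case: (mxtens_indexP l) => l1 a; case: (mxtens_indexP a) => l2 l3 /=.
by rewrite !(prod_idxE, assoc_idxVE, swap_idxE).
Qed.

Definition Rep : braided_category k :=
  @BraidedCategory k rep_tensor_category rep_braid rep_braid_nat
    rep_hexagonl rep_hexagonr.

Lemma Rep_symmetric : is_symmetric Rep.
Proof.
move=> X Y; apply: rep_hom_inj; rewrite /= basis_mx_comp basis_mx_id //.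
exact: swap_idxK.
Qed.
End Rep.
Arguments Rep k {gT} G.

Definition class_inverting (gT : finGroupType) (G : {group gT})
    (phi : gT -> gT) : Prop :=
  forall g, g \in G -> exists2 h, h \in G & phi g = (h * g^-1 * h^-1)%g.

(* Main.v *)
(* A class-inverting automorphism phi gives the strict braided functor        *)
(* X |-> X o phi, which is dualising because X o phi and X^* have the same    *)
(* character, and characters determine representations.                       *)
(*   Conversely let A be the algebra of functions on G, with G acting by      *)
(* translation. As F is braided, F(A) is a commutative algebra and hence has a*)
(* character e : F(A) -> k. Each linear form xi on X gives the map            *)
(* c_xi : X -> A, v |-> (g |-> xi(g.v)), and xi(eta_X v) = e(F(c_xi) v)       *)
(* defines a monoidal natural transformation eta_X : F(X) -> X of fibre       *)
(* functors. Monoidality applied to the coevaluation of X shows that eta_X is *)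
(* surjective, so it is bijective, since F(X) and X^* have the same dimension.*)
(* The algebra map e o F(A)(g) o eta_A^-1 : A -> k is evaluation at a point   *)
(* psi(g) of G, and then eta_X F(X)(g) = X(psi g) eta_X for every X. Thus psi *)
(* is a homomorphism and X(psi g), F(X)(g) and X(g^-1) have the same trace for*)
(* all X, so psi(g) is conjugate to g^-1; in particular psi is injective.     *)

From HB Require Import structures.
Require Import Defs.
From mathcomp Require Import all_boot all_algebra all_fingroup all_character.

Set Implicit Arguments.
Unset Strict Implicit.
Unset Printing Implicit Defensive.

Import GRing.Theory.
Local Open Scope ring_scope.

(** * Traces and eigenvectors *)

(** An automorphism acts on representations by pullback, a strict braided functor. If it is
    class-inverting, the pullback of X and the dual of X have equal traces, which in characteristic
    zero forces an isomorphism ([eq_trace_isomorphic], hence [pullback_dualising]).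

    The converse is a Tannakian reconstruction. A braided [F] carries the commutative algebra of
    functions on [G] to a commutative algebra, which has a character [e] over a closed field
    ([exists_fibre_character]). Matrix coefficients turn [e] into a monoidal transformation [eta]
    from the space of [F X] to that of [X]; duality and equality of dimensions make it invertible
    ([eta_row_free]). Transported along [eta], the action of g on every [F X] comes from a character
    of the function algebra, hence from a point psi(g) of [G] ([fun_alg_character], [eta_action]).
    As [F X] has the trace of the dual of X, the elements psi(g) and g^-1 have equal traces in all
    representations and are therefore conjugate ([eq_characters_conjugate]). *)

Lemma mxtrace_idempotent (k : fieldType) n (P : 'M[k]_n) :
  P *m P = P -> \tr P = (\rank P)%:R.
Proof.
move: (mulmx_base P) (row_base_free P) (col_base_full P).
move: (row_base P) (col_base P) => R C defP freeR fullC PP.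
(* [P] is [C *m R] with [R] right invertible and [C] left invertible, so both outer factors cancel
   in P P = P. *)
suff RC1 : R *m C = 1%:M by rewrite -{1}defP mxtrace_mulC RC1 mxtrace1.
have /(congr1 (mulmxr (pinvmx R))) : C *m (R *m C) *m R = C *m R.
  by rewrite mulmxA -mulmxA defP PP.
rewrite /= -!(mulmxA _ R) mulmxVp // !mulmx1.
move=> /(congr1 (mulmx (pinvmx C))).
by rewrite mulmxA mulVpmx // mul1mx.
Qed.

Lemma mxtrace_lin_mx (k : fieldType) m n 
    (f : {linear 'M[k]_(m, n) -> 'M[k]_(m, n)}) :
  \tr (lin_mx f) = \sum_i \sum_j f (delta_mx i j) i j.
Proof.
rewrite /mxtrace pair_big (reindex _ (curry_mxvec_bij _ _)) /=.
apply: eq_bigr => -[i j] _ /=.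
by rewrite mxE /= vec_mx_delta mxvecE.
Qed.

Section Closed.
Variable k : closedFieldType.

(** In a basis of the row space of [V], the matrix [A] restricts to a square matrix [B], whose
    characteristic polynomial has a root. *)
Lemma exists_eigenvector m n (V : 'M[k]_(m, n)) (A : 'M_n) :
  V != 0 -> stablemx V A ->
  exists2 v : 'rV_n, (v != 0) && (v <= V)%MS & exists a, v *m A = a *: v.
Proof.
move=> V0 VA; have rV : (0 < \rank V)%N by rewrite lt0n mxrank_eq0.
have /submxP[B defB] : (row_base V *m A <= row_base V)%MS.
  by rewrite stablemx_row_base.
have /closed_rootP[a] : size (char_poly B) != 1%N.
  by rewrite size_char_poly eqSS -lt0n.
rewrite -eigenvalue_root_char => /eigenvalueP[w wB w0].
exists (w *m row_base V); last first.
  by exists a; rewrite -mulmxA defB mulmxA wB scalemxAl.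
rewrite mulmx_free_eq0 ?row_base_free // w0 (submx_trans (submxMl _ _)) //.
by rewrite eq_row_base.
Qed.

(** Induction on the list inside a nonzero stable space [V]: an eigenspace of the first matrix meets
    [V] nontrivially, and by commutation the intersection is stable under the others. *)
Lemma common_left_eigenvector n (As : seq 'M[k]_n) :
  (0 < n)%N -> {in As &, forall A B, A *m B = B *m A} ->
  exists2 v : 'rV_n, v != 0 & {in As, forall A, exists a, v *m A = a *: v}.
Proof.
move=> n0 cAs.
suff: forall V : 'M_n, V != 0 -> {in As, forall A, stablemx V A} ->
    exists2 v : 'rV_n, (v != 0) && (v <= V)%MS &
      {in As, forall A, exists a, v *m A = a *: v}.
  case/(_ 1%:M) => [|A _|v /andP[v0 _] vAs]; last by exists v.
    by rewrite -mxrank_eq0 mxrank1 -lt0n.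
  by rewrite submx1.
elim: As cAs => [|A As IH] cAs V V0 VAs.
  by exists (nz_row V) => //; rewrite nz_row_eq0 V0 nz_row_sub.
have [|w /andP[w0 wV] [a wA]] := exists_eigenvector V0 (VAs A _).
  exact: mem_head.
pose W := (V :&: eigenspace A a)%MS.
have W0 : W != 0.
  apply: contraNneq w0 => W0; rewrite -submx0 -W0 sub_capmx wV.
  exact/eigenspaceP.
have [B C BAs CAs|B BAs|v /andP[v0 vW] vAs] := IH _ W W0.
- by apply: cAs; rewrite in_cons ?BAs ?CAs orbT.
- have BAs' : B \in A :: As by rewrite in_cons BAs orbT.
  rewrite sub_capmx (submx_trans (submxMr _ (capmxSl _ _))) ?VAs //.
  rewrite (submx_trans (submxMr _ (capmxSr _ _))) //.
  by apply: comm_mx_stable_eigenspace; apply: cAs; rewrite ?mem_head.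
have /andP[vV /eigenspaceP vA] : (v <= V)%MS && (v <= eigenspace A a)%MS.
  by rewrite -sub_capmx.
exists v => [|B]; first by rewrite v0.
by rewrite inE => /predU1P[->|/vAs]; first by exists a.
Qed.

Lemma char_poly_eigenvalue0 n (A : 'M[k]_n) :
  (forall a, eigenvalue A a -> a = 0) -> char_poly A = 'X^n.
Proof.
have [r defA] := closed_field_poly_normal (char_poly A).
rewrite (monicP (char_poly_monic A)) scale1r in defA.
move=> A0; have size_r : size r = n.
  by apply/succn_inj; rewrite -(size_char_poly A) defA size_prod_XsubC.
have r0 : {in r, forall z, z = 0}.
  by move=> z rz; apply: A0; rewrite eigenvalue_root_char defA root_prod_XsubC.
rewrite defA (eq_big_seq (fun=> 'X)) => [|z /r0->]; last by rewrite subr0.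
by rewrite big_const_seq count_predT size_r iter_mulr_1.
Qed.

Lemma mxtrace_eigenvalue0 n (A : 'M[k]_n) :
  (forall a, eigenvalue A a -> a = 0) -> \tr A = 0.
Proof.
case: n A => [|n] A A0; first by rewrite /mxtrace big_ord0.
have := char_poly_trace A (ltn0Sn n).
rewrite char_poly_eigenvalue0 // coefXn /= ltn_eqF //= => /eqP.
by rewrite eq_sym oppr_eq0 => /eqP.
Qed.

End Closed.

(** * Characters *)

Section EqualTraces.
Variables (k : fieldType) (gT : finGroupType) (G : {group gT}).
Hypothesis char0 : [pchar k] =i pred0.

Local Notation intertwines f rX rY :=
  (forall g, g \in G -> f *m rX g = rY g *m f).

Lemma natr_char0_neq0 n : ((n%:R : k) != 0) = (n != 0%N).
Proof. by rewrite ((pcharf0P k).1 char0). Qed.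

(** Maschke averaging: each conjugate of a pseudo-inverse of [f] under the group is again one, since
    [f] intertwines, so their mean is an equivariant one. *)
Lemma intertwiner_quasi_inverse m n (rX : mx_representation k G n)
    (rY : mx_representation k G m) (f : 'M[k]_(m, n)) :
  intertwines f rX rY ->
  exists2 f', intertwines f' rY rX & f *m f' *m f = f.
Proof.
move=> fXY; pose S := \sum_(h in G) rX h *m pinvmx f *m rY h^-1%g.
have G0 : (#|G|%:R : k) != 0 by rewrite natr_char0_neq0 -lt0n cardG_gt0.
exists (#|G|%:R^-1 *: S) => [g Gg|].
  rewrite -scalemxAl -scalemxAr; congr (_ *: _).
  rewrite mulmx_suml mulmx_sumr (reindex_inj (mulgI g)) /=.
  apply: eq_big => [h|h Gh]; first by rewrite groupMl.
  rewrite groupMl // in Gh.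
  rewrite invMg !repr_mxM ?groupV // -!mulmxA -repr_mxM ?groupV //.
  by rewrite mulVg repr_mx1 mulmx1.
rewrite -scalemxAr -scalemxAl; apply: (scalerI G0).
rewrite scalerA divff // scale1r mulmx_sumr mulmx_suml.
rewrite scaler_nat -sumr_const; apply: eq_bigr => h Gh.
have := mulmxKpV (submx_refl f); move: (pinvmx f) => f0 ff.
rewrite -!mulmxA -fXY ?groupV // (mulmxA f (rX h)) (fXY h) // -(mulmxA (rY h)).
rewrite (mulmxA f0) (mulmxA f (_ *m f)) (mulmxA f f0) ff fXY ?groupV //.
by rewrite mulmxA -repr_mxM ?groupV // mulgV repr_mx1 mul1mx.
Qed.

Lemma mulmx_deltaE (R : pzRingType) m n p q (A : 'M[R]_(m, n))
    (B : 'M[R]_(p, q)) i j a b :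
  (A *m delta_mx i j *m B) a b = A a i * B j b.
Proof.
by rewrite -(mul_delta_mx (0 : 'I_1)) mulmxA -mulmxA -colE -rowE mxE big_ord1 !mxE.
Qed.

(* The sum is #|G| times the trace of the averaging projection of 'M_n onto   *)
(* the endomorphisms of the subrepresentation on the image of p.              *)
Lemma sum_trace_idempotent_neq0 n (rX : mx_representation k G n) (p : 'M[k]_n) :
  intertwines p rX rX -> p *m p = p -> p != 0 ->
  \sum_(g in G) \tr (p *m rX g) * \tr (rX g^-1%g *m p) != 0.
Proof.
move=> pX pp p0.
have G0 : (#|G|%:R : k) != 0 by rewrite natr_char0_neq0 -lt0n cardG_gt0.
pose L (M : 'M[k]_n) : 'M[k]_n :=
  #|G|%:R^-1 *: \sum_(g in G) p *m rX g *m M *m (rX g^-1%g *m p).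
have linL : linear L.
  move=> a A B; rewrite /L scalerA mulrC -scalerA -scalerDr; congr (_ *: _).
  rewrite scaler_sumr -big_split; apply: eq_bigr => g _ /=.
  by rewrite mulmxDr mulmxDl -scalemxAr -scalemxAl.
pose lL : {linear 'M[k]_n -> 'M[k]_n} :=
  HB.pack L (GRing.isLinear.Build _ _ _ _ L linL).
have trL : \tr (lin_mx lL)
    = #|G|%:R^-1 * \sum_(g in G) \tr (p *m rX g) * \tr (rX g^-1%g *m p).
  rewrite mxtrace_lin_mx /= /L.
  transitivity (\sum_i \sum_j #|G|%:R^-1 * \sum_(g in G)
      (p *m rX g) i i * (rX g^-1%g *m p) j j : k).
    apply: eq_bigr => i _; apply: eq_bigr => j _; rewrite mxE summxE.
    congr (_ * _); apply: eq_bigr => g _.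
    exact: mulmx_deltaE.
  transitivity (\sum_i #|G|%:R^-1 * \sum_(g in G) \sum_j
      (p *m rX g) i i * (rX g^-1%g *m p) j j : k).
    by apply: eq_bigr => i _; rewrite -mulr_sumr exchange_big.
  rewrite -mulr_sumr exchange_big; congr (_ * _); apply: eq_bigr => g _.
  by rewrite /mxtrace mulr_suml; apply: eq_bigr => i _; rewrite mulr_sumr.
have invL M : intertwines M rX rX -> p *m M *m p = M -> L M = M.
  move=> MX pMp; apply: (scalerI G0); rewrite /L scalerA divff // scale1r.
  rewrite scaler_nat -sumr_const; apply: eq_bigr => g Gg.
  rewrite -!(mulmxA p) -(mulmxA (rX g)) (mulmxA M) MX ?groupV //.
  by rewrite -(mulmxA _ M) !mulmxA -(mulmxA p) -repr_mxM ?groupV // mulgV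
    repr_mx1 mulmx1.
have LX M : intertwines (L M) rX rX.
  move=> g Gg; rewrite -scalemxAl -scalemxAr; congr (_ *: _).
  rewrite mulmx_suml mulmx_sumr (reindex_inj (mulgI g)) /=.
  apply: eq_big => [h|h Gh]; first by rewrite groupMl.
  rewrite groupMl // in Gh.
  rewrite invMg !repr_mxM ?groupV // -!mulmxA pX // !mulmxA.
  rewrite pX // -!mulmxA; do 5!congr (_ *m _).
  by rewrite mulmxA -repr_mxM ?groupV // mulVg repr_mx1 mul1mx.
have pLp M : p *m L M *m p = L M.
  rewrite -scalemxAr -scalemxAl; congr (_ *: _); rewrite mulmx_sumr mulmx_suml.
  by apply: eq_bigr => g Gg; rewrite -!mulmxA pp !mulmxA pp.
have LL : lin_mx lL *m lin_mx lL = lin_mx lL.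
  apply/row_matrixP=> i; rewrite !rowE mulmxA -[delta_mx 0 i]vec_mxK.
  by rewrite !mul_vec_lin /= (invL _ (LX _) (pLp _)).
(* The trace of the idempotent [L] is its rank, which is positive because [L] fixes [p]. *)
have : (#|G|%:R^-1 : k) * \sum_(g in G) \tr (p *m rX g) * \tr (rX g^-1%g *m p) != 0.
  rewrite -trL mxtrace_idempotent // natr_char0_neq0 mxrank_eq0.
 apply: contraNneq p0 => L0; have := mul_vec_lin lL p.
  rewrite L0 mulmx0 /= invL ?pp // => /esym/eqP.
  by rewrite mxvec_eq0.
by rewrite mulf_eq0 invr_eq0 negb_or => /andP[].
Qed.

(* Here p = 1 - f'f and q = 1 - ff' project onto complements of equal         *)
(* character, so some average h = q h p is nonzero; f + h has larger rank.    *)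
Lemma intertwiner_rank_increase m n (rX : mx_representation k G n)
    (rY : mx_representation k G m) (f : 'M[k]_(m, n)) :
  {in G, forall g, \tr (rX g) = \tr (rY g)} -> intertwines f rX rY ->
  (\rank f < n)%N ->
  exists2 f1, intertwines f1 rX rY & (\rank f < \rank f1)%N.
Proof.
move=> trXY fXY f_n; have [f' fYX ff'f] := intertwiner_quasi_inverse fXY.
pose p : 'M_n := 1%:M - f' *m f; pose q : 'M_m := 1%:M - f *m f'.
have pX : intertwines p rX rX.
  by move=> g Gg; rewrite mulmxBl mulmxBr mul1mx mulmx1 -mulmxA fXY // !mulmxA fYX.
have qY : intertwines q rY rY.
  by move=> g Gg; rewrite mulmxBl mulmxBr mul1mx mulmx1 -mulmxA fYX // !mulmxA fXY.
have fp : f *m p = 0 by rewrite mulmxBr mulmx1 mulmxA ff'f subrr.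
have qf : q *m f = 0 by rewrite mulmxBl mul1mx ff'f subrr.
have pp : p *m p = p by rewrite {1}/p mulmxBl mul1mx -mulmxA fp mulmx0 subr0.
have qq : q *m q = q by rewrite {2}/q mulmxBr mulmx1 mulmxA qf mul0mx subr0.
have p0 : p != 0.
  apply: contraTneq f_n => p0; rewrite -leqNgt -{1}(mxrank1 k n).
  by rewrite -[1%:M](subrK (f' *m f)) -/p p0 add0r mxrankM_maxr.
have trpq : {in G, forall g, \tr (p *m rX g) = \tr (q *m rY g)}.
  move=> g Gg; rewrite !mulmxBl !mul1mx !raddfB /= trXY //; congr (_ - _).
  by rewrite -mulmxA fXY // mulmxA mxtrace_mulC mulmxA.
pose h M : 'M_(m, n) := \sum_(g in G) q *m rY g *m M *m (rX g^-1%g *m p).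
have hXY M : intertwines (h M) rX rY.
  move=> g Gg; rewrite mulmx_suml mulmx_sumr (reindex_inj (mulgI g)) /=.
  apply: eq_big => [x|x Gx]; first by rewrite groupMl.
  rewrite groupMl // in Gx.
  rewrite invMg !repr_mxM ?groupV // -!mulmxA pX // !mulmxA.
  rewrite qY // -!mulmxA; do 5!congr (_ *m _).
  by rewrite mulmxA -repr_mxM ?groupV // mulVg repr_mx1 mul1mx.
have qh M : q *m h M = h M.
  by rewrite mulmx_sumr; apply: eq_bigr => g _; rewrite !mulmxA qq.
have hp M : h M *m p = h M.
  by rewrite mulmx_suml; apply: eq_bigr => g _; rewrite -!mulmxA pp.
have [M hM0] : exists M, h M != 0.
  have := sum_trace_idempotent_neq0 pX pp p0.
  case: (pickP (fun ij => h (delta_mx ij.1 ij.2) != 0)) => [ij hij|h0].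
    by exists (delta_mx ij.1 ij.2).
  (* These entries add up to the sum of products of traces just shown nonzero, so not every
     [h (delta_mx i j)] vanishes. *)
  case/eqP; transitivity (\sum_i \sum_j h (delta_mx i j) i j).
    under eq_bigr => g Gg do rewrite trpq //.
    under [RHS]eq_bigr do under eq_bigr do rewrite summxE.
    under [RHS]eq_bigr do rewrite exchange_big /=.
    rewrite exchange_big /=; apply: eq_bigr => g _.
    rewrite /mxtrace mulr_suml; apply: eq_bigr => i _; rewrite mulr_sumr.
    by apply: eq_bigr => j _; rewrite mulmx_deltaE.
  rewrite big1 // => i _; rewrite big1 // => j _.
  by have /negbFE/eqP-> := h0 (i, j); rewrite mxE.
exists (f + h M) => [g Gg|]; first by rewrite mulmxDl mulmxDr fXY // hXY.
apply: rank_ltmx; rewrite ltmxE; apply/andP; split.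
  rewrite {1}(_ : f = (1%:M - q) *m (f + h M)).
  2: by rewrite mulmxBl mul1mx mulmxDr qf add0r qh addrK.
  exact: submxMl.
(* If the row space did not grow, [h M] would factor as [D *m f], and then [h M = h M *m p] would
   vanish with [f *m p]. *)
apply: contra hM0 => sub; rewrite -hp.
have /submxP[D ->] : (h M <= f)%MS.
  apply: submx_trans sub; rewrite {1}(_ : h M = q *m (f + h M)) ?submxMl //.
  by rewrite mulmxDr qf add0r qh.
by rewrite -mulmxA fp mulmx0.
Qed.

(** The traces at 1 give equal degrees in characteristic zero; starting from the zero intertwiner,
    the rank is then raised until it is full. *)
Lemma eq_trace_isomorphic m n (rX : mx_representation k G n)
    (rY : mx_representation k G m) :
  {in G, forall g, \tr (rX g) = \tr (rY g)} ->
  exists f f', [/\ intertwines f rX rY, intertwines f' rY rX,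
    f' *m f = 1%:M & f *m f' = 1%:M].
Proof.
move=> trXY.
have mn : m = n.
  have /eqP := trXY 1%g (group1 G); rewrite !repr_mx1 !mxtrace1.
  rewrite eq_sym -subr_eq0; case: (leqP n m) => [nm | /ltnW mn].
    rewrite -natrB // ((pcharf0P k).1 char0) subn_eq0 => mn.
    by apply/eqP; rewrite eqn_leq nm mn.
  rewrite -opprB oppr_eq0 -natrB // ((pcharf0P k).1 char0) subn_eq0 => nm.
  by apply/eqP; rewrite eqn_leq mn nm.
subst m.
suff [f fXY fU] : exists2 f, intertwines f rX rY & f \in unitmx.
  exists f, (invmx f); split=> [//|g Gg||]; rewrite ?mulVmx ?mulmxV //.
  by rewrite -[LHS](mulmxK fU) -(mulmxA _ _ f) -fXY // mulKmx.
suff: forall d f, intertwines f rX rY -> (n - \rank f <= d)%N ->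
    exists2 f, intertwines f rX rY & f \in unitmx.
  move/(_ n 0); apply; last by rewrite mxrank0 subn0.
  by move=> g _; rewrite mul0mx mulmx0.
elim=> [|d IH] f fXY.
  rewrite leqn0 subn_eq0 => n_f; exists f => //.
  by rewrite -row_free_unit /row_free eqn_leq rank_leq_row.
case: (leqP n (\rank f)) => [n_f _ | f_n n_d].
  by exists f => //; rewrite -row_free_unit /row_free eqn_leq rank_leq_row.
have [f1 f1XY f_f1] := intertwiner_rank_increase trXY fXY f_n.
apply: (IH f1) => //; move: n_d; rewrite !leq_subLR => /leq_trans; apply.
by rewrite addnS -addSn leq_add2r.
Qed.

Lemma mxtrace_regular g : g \in G ->
  \tr (regular_repr k G g) = (#|G| * (g == 1%g))%:R.
Proof.
move=> Gg; rewrite /mxtrace (eq_bigr (fun=> (g == 1%g)%:R)) => [|i _].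
  by rewrite sumr_const card_ord -mulrnA mulnC.
rewrite !mxE eqxx /= -(inj_eq (can_inj (@gring_valK _ G))).
rewrite gring_indexK ?groupM ?enum_valP // -{1}[enum_val i]mulg1.
by rewrite (inj_eq (mulgI _)) eq_sym.
Qed.
End EqualTraces.

(* The difference N of the class sums of x and y is central in the regular    *)
(* representation and has trace 0 on its eigenspaces, so N is nilpotent, and  *)
(* so is N y^-1, whose trace compares the coefficients of y.                  *)
Lemma eq_characters_conjugate (k : closedFieldType) (gT : finGroupType)
    (G : {group gT}) (x y : gT) :
  [pchar k] =i pred0 -> x \in G -> y \in G ->
  (forall n (rX : mx_representation k G n), \tr (rX x) = \tr (rX y)) ->
  y \in (x ^: G)%g.
Proof.
move=> char0 Gx Gy trxy; pose aG := regular_repr k G.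
pose z (a : gT) := \sum_(h in G) aG (a ^ h)%g.
have zC a g : a \in G -> g \in G -> z a *m aG g = aG g *m z a.
  move=> Ga Gg; rewrite mulmx_suml mulmx_sumr [RHS](reindex_inj (mulIg g)) /=.
  apply: eq_big => [h|h Gh]; first by rewrite groupMr.
  by rewrite -!repr_mxM ?groupJ ?groupM // conjgM conjgC.
have trz n (rX : mx_representation k G n) a : a \in G ->
    \tr (\sum_(h in G) rX (a ^ h)%g) = #|G|%:R * \tr (rX a).
  move=> Ga; rewrite raddf_sum /= mulr_natl -sumr_const; apply: eq_bigr => h Gh.
  rewrite /conjg !repr_mxM ?groupM ?groupV // mxtrace_mulC -mulmxA.
  by rewrite -repr_mxM ?groupV // mulgV repr_mx1 mulmx1.
pose N := z x - z y.
have NC g : g \in G -> N *m aG g = aG g *m N.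
  by move=> Gg; rewrite mulmxBl mulmxBr !zC.
have N_eig0 a : eigenvalue N a -> a = 0.
  move=> /eigenvalueP[v vN v0]; pose U := eigenspace N a.
  have modU : mxmodule aG U.
    by apply/mxmoduleP=> g Gg; apply: comm_mx_stable_eigenspace; apply: NC.
  have U0 : (\rank U)%:R != 0 :> k.
    rewrite natr_char0_neq0 // mxrank_eq0; apply: contraNneq v0 => U0.
    by rewrite -submx0 -U0; apply/eigenspaceP.
  (* On its eigenspace [U] the matrix [N] is the scalar [a], while its trace there is the order of
     [G] times the difference of the traces of [x] and [y], which is 0. *)
  have : \tr (\sum_(h in G) submod_repr modU (x ^ h)%g
             - \sum_(h in G) submod_repr modU (y ^ h)%g) = a * (\rank U)%:R.
    have -> : \sum_(h in G) submod_repr modU (x ^ h)%g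
             - \sum_(h in G) submod_repr modU (y ^ h)%g = a%:M.
      have subE t : t \in G -> \sum_(h in G) submod_repr modU (t ^ h)%g
          = in_submod U (val_submod 1%:M *m z t).
        by move=> _; rewrite mulmx_sumr linear_sum.
      rewrite !subE // -linearB -mulmxBr -/N.
      have /eigenspaceP-> : (val_submod (1%:M : 'M_(\rank U)) <= eigenspace N a)%MS.
        exact: val_submodP.
      by rewrite linearZ /= val_submodK scalemx1.
    by rewrite mxtrace_scalar mulr_natr.
  rewrite raddfB /= !trz // trxy subrr => /esym/eqP.
  by rewrite mulf_eq0 (negPf U0) orbF => /eqP.
(* An eigenspace of [N *m aG y^-1] is stable under the commuting [N], so it contains an eigenvector
   of [N]. This vector is killed by [N], hence by the product. *)
have trN0 : \tr (N *m aG y^-1%g) = 0.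
  apply: mxtrace_eigenvalue0 => c cB.
  have NB : comm_mx (N *m aG y^-1%g) N by rewrite /comm_mx -mulmxA -NC ?groupV.
  have [||v /andP[v0 vB] [a vN]] :=
      @exists_eigenvector k _ _ (eigenspace (N *m aG y^-1%g) c) N.
  - by case/eigenvalueP: cB => v vB; apply: contraNneq => W0;
      rewrite -submx0 -W0; apply/eigenspaceP.
  - exact: comm_mx_stable_eigenspace.
  have a0 : a = 0 by apply: N_eig0; apply/eigenvalueP; exists v.
  move/eigenspaceP: vB; rewrite mulmxA vN a0 scale0r mul0mx => /esym/eqP.
  by rewrite scaler_eq0 (negPf v0) orbF => /eqP.
have trzy a : a \in G ->
    \tr (z a *m aG y^-1%g) = (#|G| * #|[set h in G | (a ^ h == y)%g]|)%:R.
  move=> Ga; rewrite mulmx_suml raddf_sum /= -sum1dep_card big_mkcondr /=.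
  rewrite big_distrr natr_sum; apply: eq_bigr => h Gh.
  rewrite -repr_mxM ?groupV ?groupJ // mxtrace_regular ?groupM ?groupV ?groupJ //.
  by rewrite -eq_mulgV1; case: eqP.
move: trN0; rewrite mulmxBl raddfB /= !trzy // => /eqP; rewrite subr_eq0.
case: (set_0Vmem [set h in G | (x ^ h == y)%g]) => [->|[h]]; last first.
  by rewrite inE => /andP[Gh /eqP<-] _; rewrite memJ_class.
(* If no conjugate of [x] were [y], the count for [y] itself would be 0 too, yet it includes h =
   1. *)
rewrite cards0 muln0 eq_sym ((pcharf0P k).1 char0) muln_eq0.
rewrite (gtn_eqF (cardG_gt0 G)) cards_eq0 /= => /eqP/setP/(_ 1%g).
by rewrite !inE group1 conjg1 eqxx.
Qed.

(** * Pullback along an automorphism *)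

Section Pullback.
Variables (k : fieldType) (gT : finGroupType) (G : {group gT}).
Variables (phi : {perm gT}) (phiA : phi \in Aut G).

Fact Aut_in g : g \in G -> phi g \in G.
Proof. exact: Aut_closed. Qed.

Fact pullback_mx_repr (X : representation k G) : mx_repr G (fun g => X (phi g)).
Proof.
have phiM := morphicP (Aut_morphic phiA).
split=> [|g h Gg Gh]; last by rewrite phiM // repr_mxM ?Aut_in.
by rewrite -(autmE phiA) morph1 repr_mx1.
Qed.
Definition pullback X := Representation (MxRepresentation (pullback_mx_repr X)).

Fact pullback_hom_subproof X Y (f : rep_hom X Y) g :
  g \in G -> f *m pullback X g = pullback Y g *m f.
Proof. by move=> Gg; rewrite rep_homP ?Aut_in. Qed.
Definition pullback_hom X Y (f : rep_hom X Y) :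
    rep_hom (pullback X) (pullback Y) :=
  @rep_hom_of k gT G (pullback X) (pullback Y) f (pullback_hom_subproof f).

Fact pullback_linear X Y : linear (@pullback_hom X Y).
Proof. by move=> a f g; apply: rep_hom_inj. Qed.
Fact pullback_id X : pullback_hom (rep_id X) = rep_id (pullback X).
Proof. exact: rep_hom_inj. Qed.
Fact pullback_comp X Y Z (g : rep_hom Y Z) (f : rep_hom X Y) :
  pullback_hom (rep_comp g f) = rep_comp (pullback_hom g) (pullback_hom f).
Proof. exact: rep_hom_inj. Qed.

Definition pullback_functor : lin_functor (Rep k G) (Rep k G) :=
  @LinFunctor k (Rep k G) (Rep k G) pullback pullback_hom pullback_linear
    pullback_id pullback_comp.
End Pullback.

Section SameMatrices.
Variables (k : fieldType) (gT : finGroupType) (G : {group gT}).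

Variables (n : nat) (rX rY : mx_representation k G n).
Local Notation X := (Representation rX).
Local Notation Y := (Representation rY).
Hypothesis eqXY : {in G, rX =1 rY}.

Fact eq_repr_fwd_subproof g : g \in G -> 1%:M *m X g = Y g *m 1%:M.
Proof. by move=> Gg; rewrite mul1mx mulmx1 /= eqXY. Qed.
Fact eq_repr_bwd_subproof g : g \in G -> 1%:M *m Y g = X g *m 1%:M.
Proof. by move=> Gg; rewrite mul1mx mulmx1 /= eqXY. Qed.
(** Two representations with the same matrices on [G] may differ as records, so even a strict tensor
    functor needs these identity-matrix isomorphisms as its structure maps. *)
Definition eq_repr_iso : @iso k (Rep k G) X Y :=
  @rep_iso k gT G X Y (@rep_hom_of k gT G X Y 1%:M eq_repr_fwd_subproof)
    (@rep_hom_of k gT G Y X 1%:M eq_repr_bwd_subproof) (mulmx1 _) (mulmx1 _).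
End SameMatrices.

Section PullbackTensor.
Variables (k : fieldType) (gT : finGroupType) (G : {group gT}).
Variables (phi : {perm gT}) (phiA : phi \in Aut G).
Local Notation F := (pullback_functor k phiA).

Definition pullback_mu (X Y : Rep k G) :
    @iso k (Rep k G) (tens (F X) (F Y) : Rep k G) (F (tens X Y : Rep k G)) :=
  @eq_repr_iso k gT G _ (rep_tens (pullback phiA X) (pullback phiA Y))
    (pullback phiA (rep_tens X Y)) (fun _ _ => erefl).

Definition pullback_eps : @iso k (Rep k G) (@unit_obj k (Rep k G)) (F unit_obj) :=
  @eq_repr_iso k gT G _ (rep_unit k G) (pullback phiA (rep_unit k G))
    (fun _ _ => erefl).

Fact pullback_mu_nat (X X' Y Y' : Rep k G) (f : Defs.hom X X') (g : Defs.hom Y Y') :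
  pullback_mu X' Y' \oc (fmap F f \om fmap F g)
  = fmap F (f \om g) \oc pullback_mu X Y.
Proof. by apply: rep_hom_inj; rewrite /= mul1mx mulmx1. Qed.

Fact pullback_assoc (X Y Z : Rep k G) :
  fmap F (assoc X Y Z) \oc pullback_mu (X \ox Y) Z
    \oc (pullback_mu X Y \om Defs.idm (F Z))
  = pullback_mu X (Y \ox Z) \oc (Defs.idm (F X) \om pullback_mu Y Z)
    \oc assoc (F X) (F Y) (F Z).
Proof. by apply: rep_hom_inj; rewrite /= !tens1mx1 !mul1mx !mulmx1. Qed.

Fact pullback_lunit (X : Rep k G) :
  fmap F (lunit X) \oc pullback_mu unit_obj X \oc (pullback_eps \om Defs.idm (F X))
  = lunit (F X).
Proof. by apply: rep_hom_inj; rewrite /= !tens1mx1 !mulmx1. Qed.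

Fact pullback_runit (X : Rep k G) :
  fmap F (runit X) \oc pullback_mu X unit_obj \oc (Defs.idm (F X) \om pullback_eps)
  = runit (F X).
Proof. by apply: rep_hom_inj; rewrite /= !tens1mx1 !mulmx1. Qed.

Definition pullback_tensor : tensor_functor (Rep k G) (Rep k G) :=
  @TensorFunctor k (Rep k G) (Rep k G) F pullback_mu pullback_eps
    pullback_mu_nat pullback_assoc pullback_lunit pullback_runit.

Lemma pullback_braided : is_braided pullback_tensor.
Proof. by move=> X Y; apply: rep_hom_inj; rewrite /= mulmx1 mul1mx. Qed.
End PullbackTensor.

Section PullbackEquivalence.
Variables (k : fieldType) (gT : finGroupType) (G : {group gT}).

Lemma pullback_cancel (phi psi : {perm gT}) (phiA : phi \in Aut G) (psiA : psi \in Aut G) :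
  cancel psi phi ->
  nat_isomorphic (comp_functor (pullback_functor k psiA) (pullback_functor k phiA))
    (id_functor (Rep k G)).
Proof.
move=> psiK.
pose P (X : representation k G) := pullback psiA (pullback phiA X).
(* Destructing [X] exhibits both sides as representations of one degree, as [eq_repr_iso]
   requires. *)
exists (fun X : representation k G =>
  let: Representation n rX := X return @iso k (Rep k G) (P X) X in
  @eq_repr_iso k gT G n (P (Representation rX)) rX
    (fun g _ => congr1 rX (psiK g))).
move=> [n rX] [m rY] f; apply: rep_hom_inj; rewrite /=.
by rewrite mulmx1 mul1mx.
Qed.

Lemma pullback_equivalence (phi : {perm gT}) (phiA : phi \in Aut G) :
  is_equivalence (pullback_functor k phiA).
Proof.
exists (pullback_functor k (groupVr phiA)).
by split; apply: pullback_cancel => g; rewrite ?permK ?permKV.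
Qed.
End PullbackEquivalence.

(** Traces are invariant under conjugation, so [X (phi g)] has the trace of [X g^-1], which is that
    of the dual at [g]. The isomorphism is chosen object by object. *)
Lemma pullback_dualising (k : fieldType) (char0 : [pchar k] =i pred0)
    (gT : finGroupType) (G : {group gT}) (phi : {perm gT}) (phiA : phi \in Aut G) :
  class_inverting G phi -> dualising (pullback_tensor k phiA).
Proof.
move=> phi_inv X; have [g Gg|f [f' [fXY fYX f'f ff']]] :=
  @eq_trace_isomorphic k gT G char0 _ _ (pullback phiA X) (rep_dual X).
  have [h Gh phig] := phi_inv g Gg.
  rewrite /= phig mxtrace_tr !repr_mxM ?groupM ?groupV // mxtrace_mulC mulmxA.
  by rewrite -repr_mxM ?groupV // mulVg repr_mx1 mul1mx.
by exists; exact: (@rep_iso k gT G (pullback phiA X) (rep_dual X)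
  (@rep_hom_of k gT G (pullback phiA X) (rep_dual X) f fXY)
  (@rep_hom_of k gT G (rep_dual X) (pullback phiA X) f' fYX) f'f ff').
Qed.

(** * Characters of commutative algebras *)

(** For the function algebra the rows [delta_mx 0 i] are the evaluations at points of [G], so this
    lets identities there be checked pointwise. *)
Lemma eq_delta_mulmx (R : pzRingType) m n (A B : 'M[R]_(m, n)) :
  (forall i, delta_mx (0 : 'I_1) i *m A = delta_mx 0 i *m B) -> A = B.
Proof. by move=> eqAB; apply/row_matrixP=> i; rewrite !rowE. Qed.

(* tensmx_mul with the height 1 * 1 displayed as 1.                           *)
Lemma row_tensmx_mul (R : comPzRingType) m n p q (u : 'M[R]_(1, m)) (v : 'M[R]_(1, n))
    (A : 'M_(m, p)) (B : 'M_(n, q)) :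
  @mulmx R 1 _ _ (u *t v) (A *t B) = (u *m A) *t (v *m B).
Proof. exact: (@tensmx_mul R 1 m 1 n p q). Qed.

Lemma row_tensmxE (R : pzRingType) m n (u : 'M[R]_(1, m)) (v : 'M[R]_(1, n)) a i j :
  @fun_of_matrix R 1 (m * n) (u *t v) a (mxtens_index (i, j)) = u 0 i * v 0 j.
Proof.
by rewrite -(tensmxE u v); congr ((_ *t _) _ _); rewrite (ord1 a); apply: val_inj.
Qed.

Lemma delta_tens (R : pzRingType) m n (i : 'I_m) (j : 'I_n) :
  delta_mx (0 : 'I_1) i *t delta_mx (0 : 'I_1) j
  = delta_mx 0 (mxtens_index (i, j)) :> 'M[R]_(1, m * n).
Proof.
apply/matrixP=> a l; case: (mxtens_indexP l) => c d.
rewrite [LHS]row_tensmxE !mxE !eqxx (ord1 a) /= -natrM mulnb.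
by rewrite (can_eq (@mxtens_indexK _ _)) xpair_eqE.
Qed.

(** The left multiplications commute by associativity and commutativity, so some nonzero linear form
    [e] is a common eigenvector. Its eigenvalues are multiplicative, and dividing [e] by its value
    at the unit recovers them. *)
Lemma comm_algebra_character (k : closedFieldType) n (M : 'M[k]_(n, n * n))
    (U : 'M[k]_(n, 1)) :
  (0 < n)%N ->
  M *m (M *t 1%:M) = M *m (1%:M *t M) *m basis_mx k (@assoc_idx n n n) ->
  M *m basis_mx k (@swap_idx n n) = M ->
  M *m (U *t 1%:M) = basis_mx k (@lunit_idx n) ->
  exists e : 'M[k]_(1, n), e *m M = e *t e /\ e *m U = 1%:M.
Proof.
move=> n0 MA MC M1.
pose L j := \matrix_(a, b) M a (mxtens_index (j, b)).
have Msym c i j : M c (mxtens_index (i, j)) = M c (mxtens_index (j, i)).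
  by rewrite -{1}MC mulmx_basis mxE swap_idxE.
have LC i j : L i *m L j = L j *m L i.
  have LE a b x y : (L x *m L y) a b
      = (M *m (M *t 1%:M)) a (mxtens_index (mxtens_index (x, y), b)).
    rewrite MA mulmx_basis [RHS]mxE assoc_idxE !mxE sum_tens.
    rewrite [RHS](bigD1 x) //= [X in _ + X]big1 => [|z zx].
      rewrite addr0; apply: eq_bigr => c _.
      by rewrite tensmxE !mxE eqxx mul1r.
    by rewrite big1 // => c _; rewrite tensmxE mxE (negPf zx) mul0r mulr0.
  apply/matrixP=> a b; rewrite !LE mxE [RHS]mxE; apply: eq_bigr => l _.
  by case: (mxtens_indexP l) => c d; rewrite !tensmxE (Msym c i).
have [A B /codomP[i ->] /codomP[j ->]|e e0 eL] :=
  @common_left_eigenvector k n (codom L) n0; first exact: LC.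
have {eL} [lam eL] : exists lam : 'I_n -> k, forall j b,
    (e *m M) 0 (mxtens_index (j, b)) = lam j * e 0 b.
  have : forall j, exists a, e *m L j = a *: e.
    by move=> j; apply: eL; apply: codom_f.
  move/fin_all_exists=> [lam lamE]; exists lam => j b.
  have := congr1 (fun v : 'rV_n => v 0 b) (lamE j); rewrite !mxE => <-.
  by apply: eq_bigr => a _; rewrite mxE.
pose c := (e *m U) 0 0.
have lamc j : lam j * c = e 0 j.
  transitivity (\sum_b (e *m M) 0 (mxtens_index (j, b)) * U b 0).
    rewrite /c mxE mulr_sumr; apply: eq_bigr => b _.
    by rewrite eL mulrA.
  transitivity ((e *m (M *m (U *t 1%:M))) 0 (mxtens_index (0 : 'I_1, j))).
    rewrite mulmxA mxE sum_tens; apply: eq_bigr => b _.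
    rewrite (bigD1 j) //= big1 => [|d dj].
      rewrite addr0 tensmxE [1%:M _ _]mxE eqxx mulr1; congr (_ * _).
      by rewrite !mxE; apply: eq_bigr => a _; rewrite Msym.
    by rewrite tensmxE [1%:M _ _]mxE (negPf dj) !mulr0.
  by rewrite M1 mulmx_basis mxE lunit_idxE.
(* By [lamc] the form [e] is [c] times its eigenvalues, so [c = 0] would give [e = 0]. *)
have c0 : c != 0.
  apply: contraNneq e0 => c0; apply/eqP/rowP=> j.
  by rewrite -lamc c0 mulr0 mxE.
exists (c^-1 *: e); split; last first.
  apply/matrixP=> a b; rewrite (ord1 a) (ord1 b) -scalemxAl mxE -/c mulVf //.
  by rewrite mxE eqxx.
apply/matrixP=> a l; case: (mxtens_indexP l) => i j.
rewrite [RHS]row_tensmxE -scalemxAl (ord1 a) [LHS]mxE eL !mxE -!lamc.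
by rewrite [LHS]mulrCA !(mulrC _ c) !mulKf.
Qed.

(** * The algebra of functions on G *)

Section FunctionAlgebra.
Variables (k : fieldType) (gT : finGroupType) (G : {group gT}).
Local Notation rep := (representation k G).
Local Notation rhom := (@rep_hom k gT G).
Local Notation n := (gcard G).
Local Notation "''d_' i" := (delta_mx (0 : 'I_1) i)
  (at level 8, i at level 2, format "''d_' i").

(* regular_repr acts on columns by right translation, (x.v)(g) = v(gx), where *)
(* the i-th entry of v is v(enum_val i).                                      *)
Definition fun_alg : rep := Representation (regular_repr k G).

(** Pointwise multiplication: evaluating a product at a point gives the product of the values
    there. *)
Definition fun_mul_mx : 'M[k]_(n, n * n) :=
  \matrix_i delta_mx 0 (mxtens_index (i, i)).
Definition fun_unit_mx : 'M[k]_(n, 1) := const_mx 1.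

Lemma delta_fun_mul i : 'd_i *m fun_mul_mx = 'd_i *t 'd_i.
Proof. by rewrite -rowE rowK delta_tens. Qed.

Lemma delta_fun_unit i : 'd_i *m fun_unit_mx = 1%:M.
Proof. by rewrite -rowE; apply/matrixP=> a b; rewrite !mxE (ord1 a) (ord1 b). Qed.

Lemma delta_regular (i : 'I_n) g :
  'd_i *m regular_repr k G g = 'd_(gring_index G (enum_val i * g)).
Proof. by rewrite -rowE rowK. Qed.

Fact fun_mul_subproof g : g \in G ->
  fun_mul_mx *m rep_tens fun_alg fun_alg g = fun_alg g *m fun_mul_mx.
Proof.
move=> Gg; apply: eq_delta_mulmx => i /=.
by rewrite !mulmxA delta_fun_mul row_tensmx_mul delta_regular delta_fun_mul.
Qed.
Definition fun_mul : rhom (rep_tens fun_alg fun_alg) fun_alg :=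
  @rep_hom_of k gT G (rep_tens fun_alg fun_alg) fun_alg _ fun_mul_subproof.

Fact fun_unit_subproof g : g \in G ->
  fun_unit_mx *m rep_unit k G g = fun_alg g *m fun_unit_mx.
Proof.
move=> Gg; apply: eq_delta_mulmx => i /=.
by rewrite !mulmxA mulmx1 delta_regular !delta_fun_unit.
Qed.
Definition fun_unit : rhom (rep_unit k G) fun_alg :=
  @rep_hom_of k gT G (rep_unit k G) fun_alg _ fun_unit_subproof.

Lemma fun_mulA :
  fun_mul_mx *m (fun_mul_mx *t 1%:M)
  = fun_mul_mx *m (1%:M *t fun_mul_mx) *m basis_mx k (@assoc_idx n n n).
Proof.
apply: eq_delta_mulmx => i; rewrite !mulmxA delta_fun_mul !row_tensmx_mul !mulmx1.
rewrite !delta_fun_mul !delta_tens mulmx_basis; apply/matrixP=> a l.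
case: (mxtens_indexP l) => b j3; case: (mxtens_indexP b) => j1 j2.
rewrite [RHS]mxE assoc_idxE !mxE !(can_eq (@mxtens_indexK _ _)) !xpair_eqE.
by rewrite !(can_eq (@mxtens_indexK _ _)) !xpair_eqE -!andbA.
Qed.

Lemma fun_mulC : fun_mul_mx *m basis_mx k (@swap_idx n n) = fun_mul_mx.
Proof.
apply: eq_delta_mulmx => i; rewrite !mulmxA delta_fun_mul delta_tens mulmx_basis.
apply/matrixP=> a l; case: (mxtens_indexP l) => j1 j2.
rewrite mxE swap_idxE !mxE !(can_eq (@mxtens_indexK _ _)) !xpair_eqE.
by congr (nat_of_bool (_ && _))%:R; rewrite andbC.
Qed.

Lemma fun_mul1 : fun_mul_mx *m (fun_unit_mx *t 1%:M) = basis_mx k (@lunit_idx n).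
Proof.
apply: eq_delta_mulmx => i; rewrite !mulmxA delta_fun_mul !row_tensmx_mul !mulmx1.
rewrite delta_fun_unit mulmx_basis; apply/matrixP=> a l.
case: (mxtens_indexP l) => j1 j2; rewrite [RHS]mxE lunit_idxE row_tensmxE.
by rewrite !mxE (ord1 j1) (ord1 a) eqxx mul1r.
Qed.

(** The indicator functions of points are orthogonal idempotents with sum 1, so [chi] is nonzero on
    exactly one of them and equals 1 there. *)
Lemma fun_alg_character (chi : 'M[k]_(1, n)) :
  chi *m fun_mul_mx = chi *t chi -> chi *m fun_unit_mx = 1%:M ->
  exists i, chi = 'd_i.
Proof.
move=> chiM chi1.
have chi_mul i j : chi 0 i * chi 0 j = (i == j)%:R * chi 0 i.
  have := congr1 (fun A : 'M_(1, n * n) => A 0 (mxtens_index (i, j))) chiM.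
  rewrite /= row_tensmxE => <-.
  rewrite mxE (bigD1 i) //= !mxE !(can_eq (@mxtens_indexK _ _)) !xpair_eqE.
  rewrite !eqxx /= (eq_sym j) mulrC big1 ?addr0 // => l li; rewrite !mxE.
  by rewrite (can_eq (@mxtens_indexK _ _)) xpair_eqE (eq_sym i) (negPf li) mulr0.
have [i chi_i] : exists i, chi 0 i != 0.
  case: (pickP (fun i => chi 0 i != 0)) => [i chi_i|chi0]; first by exists i.
  have := congr1 (fun A : 'M_1 => A 0 0) chi1; rewrite !mxE big1 => [|j _].
    by move/eqP; rewrite eqxx eq_sym oner_eq0.
  by have /negbFE/eqP-> := chi0 j; rewrite mul0r.
exists i; apply/rowP=> j; rewrite mxE eqxx /= eq_sym; apply: (mulfI chi_i).
by rewrite chi_mul mulrC; case: eqP.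
Qed.

Section Coefficient.
Variables (X : rep) (xi : 'M[k]_(1, rdegree X)).

Definition coef_mx : 'M[k]_(n, rdegree X) :=
  \matrix_i (xi *m X (enum_val i)).

Lemma delta_coef i : 'd_i *m coef_mx = xi *m X (enum_val i).
Proof. by rewrite -rowE rowK. Qed.

Fact coef_subproof g : g \in G -> coef_mx *m X g = fun_alg g *m coef_mx.
Proof.
move=> Gg; apply: eq_delta_mulmx => i /=.
rewrite !mulmxA delta_coef delta_regular delta_coef.
by rewrite -mulmxA -repr_mxM ?enum_valP // gring_indexK ?groupM ?enum_valP.
Qed.
Definition coef : rhom X fun_alg :=
  @rep_hom_of k gT G X fun_alg coef_mx coef_subproof.
End Coefficient.

Lemma coef_linear X : linear (@coef X).
Proof.
move=> a u v; apply: rep_hom_inj => /=; apply: eq_delta_mulmx => i.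
by rewrite mulmxDr -scalemxAr !delta_coef mulmxDl -scalemxAl.
Qed.

Lemma coef_comp X Y (f : rhom X Y) xi : rep_comp (coef xi) f = coef (xi *m f).
Proof.
apply: rep_hom_inj => /=; apply: eq_delta_mulmx => i.
by rewrite mulmxA !delta_coef -!mulmxA rep_homP ?enum_valP.
Qed.

(** A product of matrix coefficients is a coefficient of the tensor product; this is what makes
    [eta] monoidal. *)
Lemma coef_tens X Y (xi : 'M_(1, rdegree X)) (zeta : 'M_(1, rdegree Y)) :
  rep_comp fun_mul (rep_tensm (coef xi) (coef zeta))
  = @coef (rep_tens X Y) (xi *t zeta).
Proof.
apply: rep_hom_inj => /=; apply: eq_delta_mulmx => i.
rewrite mulmxA delta_fun_mul row_tensmx_mul !delta_coef.
by rewrite [RHS](@delta_coef (rep_tens X Y)) /= row_tensmx_mul.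
Qed.

Lemma coef_unit : @coef (rep_unit k G) 1%:M = fun_unit.
Proof.
apply: rep_hom_inj => /=; apply: eq_delta_mulmx => i.
by rewrite (@delta_coef (rep_unit k G)) delta_fun_unit mulmx1.
Qed.

Lemma coef_fun_alg : @coef fun_alg 'd_(gring_index G 1%g) = rep_id fun_alg.
Proof.
apply: rep_hom_inj => /=; apply: eq_delta_mulmx => i.
by rewrite (@delta_coef fun_alg) delta_regular mulmx1 gring_indexK // mul1g gring_valK.
Qed.
End FunctionAlgebra.

(** * Comparison of fibre functors *)

Section RepFunctor.
Variables (k : closedFieldType) (gT : finGroupType) (G : {group gT}).
Variable F : tensor_functor (Rep k G) (Rep k G).
Local Notation rep := (representation k G).
Local Notation rhom := (@rep_hom k gT G).
Local Notation n := (gcard G).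
Local Notation A := (fun_alg k G).

(** This and the next definitions retype the data of [F] by representations and their morphisms, so
    that the functor axioms become matrix identities. *)
Definition fo (X : rep) : rep := F X.
Definition fm (X Y : rep) (f : rhom X Y) : rhom (fo X) (fo Y) := fmap F f.
Definition mu (X Y : rep) : rhom (rep_tens (fo X) (fo Y)) (fo (rep_tens X Y)) :=
  fwd (tf_mu F X Y).
Definition muV (X Y : rep) : rhom (fo (rep_tens X Y)) (rep_tens (fo X) (fo Y)) :=
  bwd (tf_mu F X Y).
Definition eps : rhom (rep_unit k G) (fo (rep_unit k G)) := fwd (tf_eps F).

Lemma fm_linear X Y : linear (@fm X Y).
Proof. move=> a f g; exact: (@fmap_linear _ _ _ F X Y a f g). Qed.
Lemma fm_id X : fm (rep_id X) = rep_id (fo X).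
Proof. exact: (fmap_id F X). Qed.
Lemma fm_comp X Y Z (g : rhom Y Z) (f : rhom X Y) :
  fm (rep_comp g f) = fm g *m fm f :> 'M_(_, _).
Proof.
exact (congr1 (@rep_mx k gT G (fo X) (fo Z)) (@fmap_comp _ _ _ F X Y Z g f)).
Qed.
Lemma muK X Y : mu X Y *m muV X Y = 1%:M.
Proof.
exact (congr1 (@rep_mx k gT G (fo (rep_tens X Y)) (fo (rep_tens X Y)))
  (fwdK (tf_mu F X Y))).
Qed.
Lemma mu_nat X X' Y Y' (f : rhom X X') (g : rhom Y Y') :
  mu X' Y' *m (fm f *t fm g) = fm (rep_tensm f g) *m mu X Y.
Proof. exact (congr1 (@rep_mx k gT G (rep_tens (fo X) (fo Y)) (fo (rep_tens X' Y')))
  (@tf_mu_nat _ _ _ F X X' Y Y' f g)). Qed.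
Lemma mu_assoc (X Y Z : rep) :
  fm (fwd (rep_assoc X Y Z)) *m mu (rep_tens X Y) Z *m (mu X Y *t 1%:M)
  = mu X (rep_tens Y Z) *m (1%:M *t mu Y Z) *m basis_mx k (@assoc_idx _ _ _).
Proof. exact (congr1 (@rep_mx k gT G (rep_tens (rep_tens (fo X) (fo Y)) (fo Z))
  (fo (rep_tens X (rep_tens Y Z)))) (tf_assoc F X Y Z)). Qed.
Lemma mu_lunit (X : rep) :
  fm (fwd (rep_lunit X)) *m mu (rep_unit k G) X *m (eps *t 1%:M)
  = basis_mx k (@lunit_idx _).
Proof.
exact (congr1 (@rep_mx k gT G (rep_tens (rep_unit k G) (fo X)) (fo X))
  (tf_lunit F X)).
Qed.
Lemma mu_braid (FB : @is_braided k (Rep k G) (Rep k G) F) (X Y : rep) :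
  fm (fwd (rep_braid X Y)) *m mu X Y = mu Y X *m basis_mx k (@swap_idx _ _).
Proof.
exact (congr1 (@rep_mx k gT G (rep_tens (fo X) (fo Y)) (fo (rep_tens Y X)))
  (FB X Y)).
Qed.
Lemma dualising_degree (FD : @dualising k (Rep k G) F) X :
  rdegree (fo X) = rdegree X.
Proof.
have [[f g /(congr1 (@rep_mx _ _ _ _ _)) gf]] := FD X.
move=> /(congr1 (@rep_mx _ _ _ _ _)) fg.
apply/eqP; rewrite eqn_leq; apply/andP; split.
  exact: mulmx1_min gf.
exact: mulmx1_min fg.
Qed.
Lemma dualising_trace (FD : @dualising k (Rep k G) F) X g : g \in G ->
  \tr (fo X g) = \tr (X g^-1%g).
Proof.
move=> Gg.
have [[a b /(congr1 (@rep_mx _ _ _ _ _)) /= ba]] := FD X.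
move=> /(congr1 (@rep_mx _ _ _ _ _)) /= ab.
have aFX : a *m fo X g = rep_dual X g *m a by apply: rep_homP.
rewrite -[fo X g]mul1mx -[1%:M]ba -mulmxA aFX mxtrace_mulC -mulmxA ab mulmx1.
exact: mxtrace_tr.
Qed.

(** The product on [fo A] is the image of the product of [A] composed with [mu]. It is associative
    and unital by the coherence of [F], and commutative because [F] is braided. *)
Lemma exists_fibre_character (FB : @is_braided k (Rep k G) (Rep k G) F) :
  (0 < rdegree (fo A))%N ->
  exists e : 'M[k]_(1, rdegree (fo A)),
    e *m (fm (fun_mul k G) *m mu A A) = e *t e /\
    e *m (fm (fun_unit k G) *m eps) = 1%:M.
Proof.
move=> n0; apply: comm_algebra_character => //.
- have tens_mul1 : (fm (fun_mul k G) *m mu A A) *t 1%:M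
      = (fm (fun_mul k G) *t fm (rep_id A)) *m (mu A A *t 1%:M).
    by rewrite tensmx_mul fm_id mulmx1.
  have tens_1mul : 1%:M *t (fm (fun_mul k G) *m mu A A)
      = (fm (rep_id A) *t fm (fun_mul k G)) *m (1%:M *t mu A A).
    by rewrite tensmx_mul fm_id mulmx1.
  rewrite tens_mul1 tens_1mul -!mulmxA.
  rewrite (mulmxA (mu A A)) mu_nat (mulmxA (mu A A)) mu_nat !mulmxA -!fm_comp.
  have -> : rep_comp (fun_mul k G) (rep_tensm (fun_mul k G) (rep_id A))
    = rep_comp (rep_comp (fun_mul k G) (rep_tensm (rep_id A) (fun_mul k G)))
       (fwd (rep_assoc A A A)).
    by apply: rep_hom_inj; apply: fun_mulA.
  by rewrite [in LHS]fm_comp -!mulmxA; congr (_ *m _); rewrite !mulmxA mu_assoc.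
- rewrite -mulmxA -mu_braid // mulmxA -fm_comp; congr (rep_mx (fm _) *m _).
  by apply: rep_hom_inj; apply: fun_mulC.
have -> : (fm (fun_unit k G) *m eps) *t 1%:M
    = (fm (fun_unit k G) *t fm (rep_id A)) *m (eps *t 1%:M).
  by rewrite tensmx_mul fm_id mulmx1.
rewrite -mulmxA (mulmxA (mu A A)) mu_nat !mulmxA -fm_comp -mu_lunit.
congr (rep_mx (fm _) *m _ *m _).
by apply: rep_hom_inj; apply: fun_mul1.
Qed.

(** * The monoidal transformation attached to a character *)

Section Eta.
Variable e : 'M[k]_(1, rdegree (fo A)).
Hypothesis eM : e *m (fm (fun_mul k G) *m mu A A) = e *t e.
Hypothesis eU : e *m (fm (fun_unit k G) *m eps) = 1%:M.

(** Given by its transpose: a linear form [xi] on [X] is pulled back to a form on [fo X] by applying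
    [F] to its matrix coefficient and then [e]. *)
Definition eta (X : rep) : 'M[k]_(rdegree X, rdegree (fo X)) :=
  lin1_mx (fun xi => e *m fm (coef xi)).

Lemma mul_eta X xi : xi *m eta X = e *m fm (coef xi).
Proof.
pose T (xi : 'M[k]_(1, rdegree X)) := e *m fm (coef xi).
have linT : linear T.
  by move=> a u v; rewrite /T coef_linear fm_linear mulmxDr -scalemxAr.
pose lT : {linear 'rV[k]_(rdegree X) -> 'rV[k]_(rdegree (fo X))} :=
  HB.pack T (GRing.isLinear.Build _ _ _ _ T linT).
exact: (mul_rV_lin1 lT).
Qed.

Lemma eta_nat X Y (f : rhom X Y) : eta Y *m fm f = f *m eta X.
Proof.
apply: eq_delta_mulmx => i.
by rewrite !mulmxA !mul_eta -mulmxA -fm_comp coef_comp.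
Qed.

Lemma eta_tens X Y : eta (rep_tens X Y) *m mu X Y = eta X *t eta Y.
Proof.
apply: eq_delta_mulmx => l; case: (mxtens_indexP l) => i j.
rewrite -delta_tens row_tensmx_mul mulmxA (@mul_eta (rep_tens X Y)) -coef_tens.
rewrite fm_comp -!mulmxA -mu_nat (mulmxA (fm _)) (mulmxA e) eM row_tensmx_mul.
by rewrite !mul_eta.
Qed.

Lemma eta_unit : eta (rep_unit k G) *m eps = 1%:M.
Proof.
rewrite -[LHS]mul1mx mulmxA (@mul_eta (rep_unit k G)) coef_unit.
by rewrite -mulmxA eU.
Qed.

(** Naturality and monoidality show that [eta X *t eta Y] sends [C], the coevaluation transported by
    [F], to the coevaluation of [X]. With [C] read as a matrix [D], this says that [D *m (eta Y)^T]
    is a right inverse of [eta X]. *)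
Lemma eta_row_free X : row_free (eta X).
Proof.
pose Y := rep_dual X.
pose C := muV X Y *m (fm (rep_coev X) *m eps).
have etaC : (eta X *t eta Y) *m C = coev_mx k (rdegree X).
  rewrite -eta_tens /C -mulmxA (mulmxA (mu X Y)) muK mul1mx mulmxA.
  by rewrite (@eta_nat (rep_unit k G) (rep_tens X Y)) -mulmxA eta_unit mulmx1.
pose D := \matrix_(i, j) C (mxtens_index (i, j)) 0.
apply/row_freeP; exists (D *m (eta Y)^T).
apply/matrixP=> i j; transitivity (coev_mx k (rdegree X) (mxtens_index (i, j)) 0).
  rewrite -etaC [LHS]mxE [RHS]mxE sum_tens; apply: eq_bigr => a _.
  rewrite [X in _ * X = _]mxE mulr_sumr; apply: eq_bigr => b _.
  by rewrite tensmxE -mulrA [D _ _]mxE [_^T _ _]mxE [eta Y _ _ * _]mulrC.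
by rewrite /coev_mx mxE ev_mxE mxE.
Qed.

Hypothesis degF : forall X, rdegree (fo X) = rdegree X.

Lemma etaKV X : eta X *m pinvmx (eta X) = 1%:M.
Proof. exact: mulmxVp (eta_row_free X). Qed.

Lemma etaVK X : pinvmx (eta X) *m eta X = 1%:M.
Proof. apply: mulVpmx; rewrite /row_full (eqnP (eta_row_free X)) degF //. Qed.

(** The action of [g] on [fo A] respects product and unit, so [chi] is a character of the function
    algebra and hence evaluation at a point [s]. *)
Lemma eta_action g : g \in G -> exists2 s, s \in G &
  forall X, eta X *m fo X g = X s *m eta X.
Proof.
move=> Gg; pose chi := e *m fo A g *m pinvmx (eta A).
have chiE : chi *m eta A = e *m fo A g by rewrite -mulmxA etaVK mulmx1.
have [||i chi_i] := @fun_alg_character k gT G chi.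
- have eta2K : (eta A *t eta A) *m (pinvmx (eta A) *t pinvmx (eta A)) = 1%:M.
    by rewrite tensmx_mul etaKV tens1mx1.
  rewrite -[LHS]mulmx1 -[RHS]mulmx1 -eta2K !mulmxA; congr (_ *m _).
  rewrite row_tensmx_mul chiE -eta_tens -mulmxA.
  rewrite (mulmxA (fun_mul_mx k G) (eta (rep_tens A A)) (mu A A)).
  rewrite -(@eta_nat _ _ (fun_mul k G)) !mulmxA chiE.
  rewrite -(mulmxA e) -(rep_homP (fm (fun_mul k G)) Gg) -!mulmxA.
  rewrite -(rep_homP (mu A A) Gg).
  by rewrite (mulmxA (fm _)) (mulmxA e) eM row_tensmx_mul.
- rewrite -[LHS]mulmx1 -[X in _ *m X = _]eta_unit !mulmxA -(mulmxA chi).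
  rewrite -(@eta_nat _ _ (fun_unit k G)) mulmxA chiE -(mulmxA e).
  rewrite -(rep_homP (fm (fun_unit k G)) Gg) -!mulmxA -(rep_homP eps Gg).
  by rewrite [eps *m _]mulmx1 eU.
exists (enum_val i); first exact: enum_valP.
(* The image of a coefficient map is equivariant, which moves [g] from [fo X] to [fo A], where [chi]
   replaces it by evaluation at [s]. *)
move=> X; apply: eq_delta_mulmx => j; rewrite !mulmxA mul_eta -(mulmxA e).
rewrite (rep_homP (fm (coef _)) Gg).
rewrite mulmxA -chiE chi_i -(mulmxA _ (eta A)) eta_nat mulmxA /=.
by rewrite delta_coef.
Qed.

Lemma eta_trace X g s : eta X *m fo X g = X s *m eta X -> \tr (fo X g) = \tr (X s).
Proof.
move=> etag; rewrite -[X s]mulmx1 -(etaKV X) mulmxA -etag -mulmxA mxtrace_mulC.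
by rewrite -mulmxA etaVK mulmx1.
Qed.

(** Cancelling the invertible [eta A] gives [A r = A (s * t)], and the regular representation is
    faithful: applied to the basis row of 1 it returns the group element. *)
Lemma eta_action_hom g h s t r :
  g \in G -> h \in G -> s \in G -> t \in G -> r \in G ->
  eta A *m fo A g = A s *m eta A -> eta A *m fo A h = A t *m eta A ->
  eta A *m fo A (g * h)%g = A r *m eta A -> r = (s * t)%g.
Proof.
move=> Gg Gh Gs Gt Gr etag etah etagh.
have [B etaB] : exists B, eta A *m B = 1%:M.
  by exists (pinvmx (eta A)); apply: etaKV.
have : A r = A (s * t)%g.
  rewrite -[LHS]mulmx1 -[RHS]mulmx1 -etaB !mulmxA -etagh; congr (_ *m _).
  by rewrite !repr_mxM // mulmxA etag -[LHS]mulmxA etah mulmxA.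
move=> /(congr1 (mulmx (delta_mx (0 : 'I_1) (gring_index G 1%g)))).
rewrite !delta_regular !gring_indexK // !mul1g => /rowP/(_ (gring_index G r)).
rewrite !mxE !eqxx /=; case: eqP => [|_ /eqP]; last by rewrite oner_eq0.
by move/(congr1 enum_val); rewrite !gring_indexK ?groupM.
Qed.
End Eta.
End RepFunctor.

(** * From the transformation to the automorphism *)

Theorem dualising_class_inverting (k : closedFieldType) (char0 : [pchar k] =i pred0)
    (gT : finGroupType) (G : {group gT}) (F : tensor_functor (Rep k G) (Rep k G)) :
  is_braided F -> dualising F ->
  exists2 phi : {perm gT}, phi \in Aut G & class_inverting G phi.
Proof.
move=> FB FD; have degF := dualising_degree FD.
have [|e [eM eU]] := exists_fibre_character FB.
  by rewrite degF; apply: cardG_gt0.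
(* Membership is placed under the existential so that finite choice over all of [gT] applies;
   outside [G] the value 1 is arbitrary. *)
have etaG : forall g, exists s, g \in G -> s \in G /\
    forall X, eta e X *m fo F X g = X s *m eta e X.
  move=> g; case Gg: (g \in G); last by exists 1%g.
  by have [s Gs etas] := eta_action eM eU degF Gg; exists s.
have [psi psiP] := fin_all_exists etaG.
have psiG g : g \in G -> psi g \in G by case/psiP.
have psi_eta g X : g \in G -> eta e X *m fo F X g = X (psi g) *m eta e X.
  by move=> Gg; case: (psiP g Gg).
have psiM : {in G &, {morph psi : g h / (g * h)%g}}.
  move=> g h Gg Gh.
  have Ggh := groupM Gg Gh.
  exact: (eta_action_hom eM eU Gg Gh (psiG _ Gg) (psiG _ Gh) (psiG _ Ggh)
    (psi_eta _ _ Gg) (psi_eta _ _ Gh) (psi_eta _ _ Ggh)).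
have psi_class g : g \in G -> psi g \in (g^-1 ^: G)%g.
  move=> Gg; apply: eq_characters_conjugate => // [||d rX]; rewrite ?groupV ?psiG //.
  have := eta_trace eM eU degF (psi_eta g (Representation rX) Gg).
  by rewrite dualising_trace.
pose f := Morphism psiM.
(* If [psi g] is 1, then g^-1 is conjugate to 1, so g is 1. *)
have injf : ('injm f)%g.
  apply/subsetP=> g; rewrite !inE => /andP[Gg /eqP psi1].
  have /imsetP[h Gh] := psi_class g Gg; rewrite [psi g]psi1 => /eqP.
  by rewrite eq_sym conjg_eq1 invg_eq1.
have fG : (f @* G)%g = G.
  apply/eqP; rewrite eqEcard card_injm // leqnn andbT.
  by apply/subsetP=> _ /morphimP[g _ Gg ->]; apply: psiG.
exists (aut injf fG) => [|g Gg]; first exact: Aut_aut.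
have /imsetP[h Gh psig] := psi_class g Gg.
(* Conjugation [x ^ h] is h^-1 x h, the opposite of the convention in [class_inverting]. *)
exists h^-1%g; first by rewrite groupV.
by rewrite autE //= psig invgK /conjg mulgA.
Qed.

Theorem proposition2p6 (k : closedFieldType) (char0 : [pchar k] =i pred0)
    (gT : finGroupType) (G : {group gT}) :
  (exists F : tensor_functor (Rep k G) (Rep k G),
      [/\ is_equivalence F, is_braided F & dualising F])
  <->
  (exists2 phi : {perm gT}, phi \in Aut G & class_inverting G phi).
Proof.
split=> [[F [_ FB FD]] | [phi phiA phi_inv]].
  exact: dualising_class_inverting FB FD.
exists (pullback_tensor k phiA); split; last exact: pullback_dualising.
  exact: pullback_equivalence.
exact: pullback_braided.
Qed.
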